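(* Let $d\in\{2,3,4\}$, $N\ge1$, $L$ even, $a\in(0,1]$, $g^2\in(0,g_0^2]$ with $0<g_0<\infty$, and let $Z^{u}_\Lambda(a)$ and $Z^{u,P}_\Lambda(a)$ be the Wilson partition functions with gauge group $\mathrm U(N)$ and with free and periodic boundary conditions, respectively. Define $$z_u=\int_{\mathrm U(N)}\exp\Big[-2\frac{a^{d-4}}{g^2}\,\mathrm{Re}\,\mathrm{Tr}(1-U)\Big]d\sigma(U),\qquad z_\ell=\int_{\mathrm U(N)}\exp\Big[-2C^2\frac{a^{d-4}}{g^2}(d-1)\,\mathrm{Tr}X^2\Big]d\sigma(U),$$ where $C^2=4N$ and $U=e^{iX}$ with $X$ self-adjoint with eigenvalues the angular eigenvalues $\lambda_1,\dots,\lambda_N\in(-\pi,\pi]$ of $U$, so that, writing $X=\sum_{\alpha=1}^{N^2}x_\alpha\theta_\alpha$, $\mathrm{Tr}X^2=\sum_{\alpha=1}^{N^2}x_\alpha^2=\sum_{k=1}^N\lambda_k^2$. Then: Free b.c.: $\quad z_\ell^{\Lambda_r}\le Z^u_\Lambda(a)\le z_u^{\Lambda_r}$. Periodic b.c.: $\quad z_\ell^{\Lambda_r+\Lambda_e}\le Z^{u,P}_\Lambda(a)\le Z^u_\Lambda(a)\le z_u^{\Lambda_r}$.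
   Context: $d\sigma$ is the normalized Haar measure on $\mathrm U(N)$; $\theta_\alpha$, $\alpha=1,\dots,N^2$, is a basis of the self-adjoint $N\times N$ matrices with $\mathrm{Tr}\,\theta_\alpha\theta_\beta=\delta_{\alpha\beta}$; the angular eigenvalues of a unitary $U$ are the $\lambda_k\in(-\pi,\pi]$ such that $e^{i\lambda_k}$ are its eigenvalues. Lattice: $\Lambda\subset a\mathbb Z^d$ is the hypercubic lattice with $L$ sites on a side, $\Lambda_s=L^d$ sites, coordinate directions $\mu=0,\dots,d-1$ with unit vectors $e^\mu$. Free b.c. bonds are $[x,x+ae^\mu]$ with both ends in $\Lambda$; there are $dL^{d-1}(L-1)$ of them. For periodic b.c. there are $\Lambda_e=dL^{d-1}$ extra bonds: in each coordinate direction, on each lattice line, a bond from the last site to the first one. A plaquette is a minimal square formed by four of the bonds: $p=p_{\mu\nu}(x)$, $\mu<\nu$, has bonds $b_1=[x,x+ae^\mu]$, $b_2=[x+ae^\mu,x+ae^\mu+ae^\nu]$, $b_3=[x+ae^\nu,x+ae^\nu+ae^\mu]$, $b_4=[x,x+ae^\nu]$ (with coordinates understood periodically for periodic b.c.). To each bond $b$ is assigned $U_b\in\mathrm U(N)$, and $U_p=U_{b_1}U_{b_2}U_{b_3}^\dagger U_{b_4}^\dagger$, $A_p(U_p)=2\,\mathrm{Re}\,\mathrm{Tr}(1-U_p)$. With $B$ denoting free ($B$ blank) or periodic ($B=P$) b.c., $$Z^{u,B}_\Lambda(a)=\int\exp\Big[-\frac{a^{d-4}}{g^2}\sum_pA_p(U_p)\Big]\prod_bd\sigma(U_b),$$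 with sum over the plaquettes and product over the bonds of the lattice with b.c. $B$. $\Lambda_r$ is the number of free b.c. bonds not belonging to a maximal tree of $\Lambda$ (the retained bonds after gauge fixing): $\Lambda_r=(L-1)^2$, $(2L+1)(L-1)^2$, $(3L^3-L^2-L-1)(L-1)$ for $d=2,3,4$, respectively. *)

(* Defs.v *)
From HB Require Import structures.
From mathcomp Require Import all_boot all_order all_algebra.
From mathcomp Require Import complex.
From mathcomp Require Import all_classical all_reals all_analysis.

Set Implicit Arguments.
Unset Strict Implicit.
Unset Printing Implicit Defensive.

Import Order.TTheory GRing.Theory Num.Theory.
Import numFieldNormedType.Exports.

Local Open Scope classical_set_scope.
Local Open Scope ring_scope.
Local Open Scope complex_scope.
Local Open Scope sesquilinear_scope.

Section Unitary.
Variables (R : realType) (N : nat).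

Definition unitary := {U : 'M[R[i]]_N | U \is unitarymx}.

Definition umx (U : unitary) : 'M[R[i]]_N := sval U.

Fact uone_subproof : (1%:M : 'M[R[i]]_N) \is unitarymx.
Proof. by apply/unitarymxP; rewrite trmx1 map_mx1 mulmx1. Qed.

Definition uone : unitary := exist _ 1%:M uone_subproof.

Definition umul (U V : unitary) : unitary :=
  exist _ (umx U *m umx V) (mul_unitarymx (svalP U) (svalP V)).

HB.instance Definition _ := Choice.on unitary.
HB.instance Definition _ := isPointed.Build unitary uone.

(* The complex numbers carry their metric topology only under the alias
   R[i]^o; matrices over it have the product topology. *)
Definition unitary_open : set (set unitary) :=
  preimage_set_system setT (umx : unitary -> 'M[R[i]^o]_N) open.

(* U(N) with its Borel sigma-algebra. *)
Definition UN := g_sigma_algebraType unitary_open.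

(* Left invariance characterizes the normalized Haar measure of the compact
   group U(N) (right invariance follows). *)
Definition is_haar (sigma : probability UN R) : Prop :=
  forall (V : UN) (A : set UN), measurable A ->
    sigma [set U : UN | A (umul V U)] = sigma A.

Definition expmx (A : 'M[R[i]]_N) : 'M[R[i]]_N :=
  lim (series (fun k => (k`!%:R^-1 *: A ^+ k : 'M[R[i]^o]_N)) @ \oo).

Definition expi (t : R) : R[i] := cos t +i* sin t.

(* The eigenvalues are counted with algebraic multiplicity, as roots of the
   characteristic polynomial. *)
Definition angular_eigenvalues (U : 'M[R[i]]_N) (lam : 'I_N -> R) : Prop :=
  (forall k, - pi < lam k <= pi) /\
  char_poly U = \prod_k ('X - (expi (lam k))%:P).

Definition is_angular_mx (U X : 'M[R[i]]_N) : Prop :=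
  [/\ X ^t* = X,
      expmx ('i *: X) = U &
      exists lam : 'I_N -> R, angular_eigenvalues U lam /\
        char_poly X = \prod_k ('X - ((lam k)%:C)%:P)].

Definition angular_mx (U : 'M[R[i]]_N) : 'M[R[i]]_N :=
  xget 0 [set X | is_angular_mx U X].

(* A set of N ^ 2 such matrices is linearly independent over the reals, hence
   a basis of the self-adjoint matrices. *)
Definition is_selfadjoint_onb (theta : 'I_(N ^ 2) -> 'M[R[i]]_N) : Prop :=
  (forall al, (theta al) ^t* = theta al) /\
  (forall al be, \tr (theta al *m theta be) = (al == be)%:R).

End Unitary.

Section TupleProbability.
Context {d : measure_display} {T : measurableType d} {R : realType}.
Variable P : probability T R.

Definition cons_tuple n (x : T * n.-tuple T) : n.+1.-tuple T :=
  [the n.+1.-tuple T of x.1 :: x.2].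

Lemma measurable_cons_tuple n : measurable_fun setT (@cons_tuple n).
Proof. exact: measurable_cons. Qed.

HB.instance Definition _ n :=
  isMeasurableFun.Build _ _ _ _ (@cons_tuple n) (@measurable_cons_tuple n).

Fixpoint tuple_prob (n : nat) : probability (n.-tuple T) R :=
  match n with
  | 0 => (dirac [tuple] : probability (0.-tuple T) R)
  | m.+1 => distribution (P \x tuple_prob m)%E (@cons_tuple m)
  end.

End TupleProbability.

Section Lattice.
Variables (d L : nat).

(* The lattice site a * n is encoded by its integer coordinates n. *)
Definition site := {ffun 'I_d -> 'I_L}.

(* One step in direction mu, with the coordinate understood periodically. *)
Definition shift (mu : 'I_d) (x : site) : site :=
  [ffun nu => if nu == mu then ordS (x nu) else x nu].

(* The pair (x, mu) encodes the bond from x to shift mu x; for L = 2 the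
   bonds (x, mu) and (shift mu x, mu) are thus different bonds joining the
   same two sites. *)
Definition bond := (site * 'I_d)%type.

Inductive boundary := Free | Periodic.

Definition bonds (B : boundary) : {set bond} :=
  match B with
  | Free => [set b : bond | ((b.1 b.2).+1 < L)%N]
  | Periodic => [set: bond]
  end.

(* The triple (x, mu, nu) encodes p_{mu nu}(x). *)
Definition plaquette := (site * 'I_d * 'I_d)%type.

Definition b1 (p : plaquette) : bond := let: (x, mu, nu) := p in (x, mu).
Definition b2 (p : plaquette) : bond :=
  let: (x, mu, nu) := p in (shift mu x, nu).
Definition b3 (p : plaquette) : bond :=
  let: (x, mu, nu) := p in (shift nu x, mu).
Definition b4 (p : plaquette) : bond := let: (x, mu, nu) := p in (x, nu).

Definition plaquettes (B : boundary) : {set plaquette} :=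
  [set p : plaquette | [&& (p.1.2 < p.2)%N, b1 p \in bonds B,
    b2 p \in bonds B, b3 p \in bonds B & b4 p \in bonds B]].

Definition adjacent (T : {set bond}) : rel site := fun x y =>
  [exists mu, ((x, mu) \in T) && (y == shift mu x)
           || ((y, mu) \in T) && (x == shift mu y)].

(* A set of bonds has no loop when no bond of it joins two sites that are
   already joined through its other bonds. *)
Definition loopless (T : {set bond}) : bool :=
  [forall b in T, ~~ connect (adjacent (T :\ b)) b.1 (shift b.2 b.1)].

Definition maximal_tree (T : {set bond}) : bool :=
  maxset (fun T' : {set bond} => (T' \subset bonds Free) && loopless T') T.

Definition Lambda_r (T : {set bond}) : nat := #|bonds Free :\: T|.

Definition Lambda_e : nat := (d * L ^ d.-1)%N.

End Lattice.

Section Partition.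
Variables (R : realType) (N d L : nat).

(* A configuration lists the gauge variables along the enumeration of the
   bonds. The default uone is only reached off the bonds of B. *)
Definition config (B : boundary) := #|bonds d L B|.-tuple (UN R N).

Definition link (B : boundary) (U : config B) (b : bond d L) : 'M[R[i]]_N :=
  umx (nth (uone R N) U (index b (enum (bonds d L B)))).

Definition plaquette_mx (B : boundary) (U : config B) (p : plaquette d L) :
    'M[R[i]]_N :=
  link U (b1 p) *m link U (b2 p) *m (link U (b3 p)) ^t* *m (link U (b4 p)) ^t*.

Definition plaquette_action (W : 'M[R[i]]_N) : R :=
  2 * complex.Re (\tr (1%:M - W)).

Variables (a g : R) (sigma : probability (UN R N) R).

Definition partition_function (B : boundary) : \bar R :=
  (\int[tuple_prob sigma #|bonds d L B|]_U
    (expR (- (a ^ (d%:Z - 4) / g ^+ 2 *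
      \sum_(p in plaquettes d L B)
         plaquette_action (plaquette_mx (U : config B) p))))%:E)%E.

Definition z_u : \bar R :=
  (\int[sigma]_U
    (expR (- 2 * (a ^ (d%:Z - 4) / g ^+ 2) *
      complex.Re (\tr (1%:M - umx U))))%:E)%E.

Definition C2 : R := 4 * N%:R.

Definition z_l : \bar R :=
  (\int[sigma]_U
    (expR (- 2 * C2 * (a ^ (d%:Z - 4) / g ^+ 2) * (d%:R - 1) *
      complex.Re (\tr (angular_mx (umx U) *m angular_mx (umx U)))))%:E)%E.

End Partition.

(* Main.v *)
Require Import Defs.
From HB Require Import structures.
From mathcomp Require Import all_boot all_order all_algebra.
From mathcomp Require Import complex.
From mathcomp Require Import all_classical all_reals all_analysis.
From mathcomp Require Import measurable_realfun.
From mathcomp Require Import ring lra.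
Import Order.TTheory GRing.Theory Num.Theory.
Import numFieldNormedType.Exports.
Local Open Scope classical_set_scope.
Local Open Scope ring_scope.
Local Open Scope complex_scope.
Local Open Scope sesquilinear_scope.

(** Let the comb be the maximal tree of the bonds (x, mu) with x_nu = 0 for all
nu < mu. Every maximal tree has L^d - 1 bonds, as the comb does: a bond of a
loopless set halves the number of boolean functions on the sites that are
constant along the bonds of the set, and only the two constant functions remain
for a maximal tree.

Upper bound. To each free bond c = (x, mu) off the comb we attach a plaquette
that contains c and otherwise only bonds preceding c in the lexicographic order
on (mu, sum of the coordinates of x). As all actions are nonnegative, the other
plaquettes may be dropped. Integrating the retained bonds in decreasing order,
each one occurs in a single remaining plaquette, and the invariance of the Haar
measure turns its integral into z_u.

Lower bound. Gauge invariance and the invariance of the Haar measure allow the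
comb variables to be set to 1. Since A_p(U) = |1 - U|^2 in the Hilbert-Schmidt
norm, the parallelogram law gives A_p(U_p) <= 4 (A(U_1) + ... + A(U_4)), while
A(U) = sum_k 2 (1 - cos lambda_k) <= Tr X^2, and a bond lies in at most 2 (d - 1)
plaquettes. Hence the Boltzmann factor dominates a product of one-bond functions
over the retained bonds, even with C^2 = 4 instead of 4 N.

The periodic partition function is at most the free one because the action is
nonnegative and the variables of the extra bonds integrate to 1. *)

Set Implicit Arguments.
Unset Strict Implicit.
Unset Printing Implicit Defensive.

(* Names of Defs that later libraries shadow. *)
Local Notation shift := Defs.shift.
Local Notation adjacent := Defs.adjacent.
Local Notation cons_tuple := Defs.cons_tuple.

(** * Maximal trees and the comb *)

Section SpanningTrees.
Local Open Scope nat_scope.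
Variables d L : nat.
Implicit Types (T : {set bond d L}) (f g : {ffun site d L -> bool}).

(** The zeroth cohomology of the graph T with coefficients in F_2: its cardinality is 2 to the
    number of connected components, so components are counted without being constructed. *)
Definition locally_constant T : {set {ffun site d L -> bool}} :=
  [set f : {ffun site d L -> bool} |
    [forall b in T, f b.1 == f (shift b.2 b.1)]].

Lemma locally_constantP T f :
  reflect (forall b, b \in T -> f b.1 = f (shift b.2 b.1))
          (f \in locally_constant T).
Proof.
rewrite inE; apply: (iffP forall_inP) => H b /H; first by move=> /eqP.
by move=> ->.
Qed.

Lemma locally_constant_connect T f x y : f \in locally_constant T ->
  connect (adjacent T) x y -> f x = f y.
Proof.
move=> /locally_constantP fT /connectP[p]; elim: p x => [|z p IH] x /=.
  by move=> _ ->.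
move=> /andP[/existsP[mu /orP[]/andP[xT /eqP zE]] pz] /(IH _ pz) <-.
  by rewrite (fT _ xT) zE.
by rewrite zE (fT _ xT).
Qed.

Definition component T x : {ffun site d L -> bool} :=
  [ffun y => connect (adjacent T) x y].

Lemma component_locally_constant T x : component T x \in locally_constant T.
Proof.
apply/locally_constantP => -[z mu] zT; rewrite !ffunE /=.
by apply/idP/idP => xz; apply: (connect_trans xz); apply: connect1;
  apply/existsP; exists mu; rewrite zT eqxx ?orbT.
Qed.

Definition xorf f g : {ffun site d L -> bool} := [ffun x => f x (+) g x].

Lemma xorfE f g x : xorf f g x = f x (+) g x.
Proof. by rewrite ffunE. Qed.

Lemma xorfK f : involutive (xorf f).
Proof. by move=> g; apply/ffunP => x; rewrite !ffunE addKb. Qed.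

Lemma locally_constant_xor T f g : f \in locally_constant T ->
  g \in locally_constant T -> xorf f g \in locally_constant T.
Proof.
move=> /locally_constantP fT /locally_constantP gT; apply/locally_constantP.
by move=> b bT; rewrite !ffunE fT// gT.
Qed.

Lemma locally_constantS T T' : T \subset T' ->
  locally_constant T' \subset locally_constant T.
Proof.
move=> /fintype.subsetP TT'; apply/fintype.subsetP => f /locally_constantP fT'.
by apply/locally_constantP => b /TT' /fT'.
Qed.

Lemma locally_constantU1 T b f : f \in locally_constant T ->
  f b.1 = f (shift b.2 b.1) -> f \in locally_constant (b |: T).
Proof.
move=> /locally_constantP fT fb; apply/locally_constantP => c.
by rewrite finset.in_setU1 => /predU1P[->//|]; exact: fT.
Qed.

Lemma loopless_connect T b : loopless T -> b \in T ->
  ~~ connect (adjacent (T :\ b)) b.1 (shift b.2 b.1).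
Proof. by move=> /forall_inP; apply. Qed.

Lemma adjacentS T T' : T \subset T' -> subrel (adjacent T) (adjacent T').
Proof.
move=> /fintype.subsetP TT' x y /existsP[mu /orP[]/andP[/TT' xT yE]];
by apply/existsP; exists mu; rewrite xT yE ?orbT.
Qed.

Lemma looplessS T T' : T \subset T' -> loopless T' -> loopless T.
Proof.
move=> TT' lT'; apply/forall_inP => b bT.
apply: contra (loopless_connect lT' (fintype.subsetP TT' _ bT)).
apply: connect_sub => x y xy; apply: connect1; apply: adjacentS xy.
exact: finset.setSD.
Qed.

(** Without b its two ends lie in different components, separated by the indicator h of the
    component of one end. Adding h over F_2 exchanges the functions that agree at the ends of b with
    those that differ there. *)
Lemma card_locally_constantD1 T b : loopless T -> b \in T ->
  #|locally_constant (T :\ b)| = (2 * #|locally_constant T|)%N.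
Proof.
move=> lT bT; pose h := component (T :\ b) b.1.
have hb1 : h b.1 by rewrite ffunE connect0.
have hb2 : h (shift b.2 b.1) = false.
  by rewrite ffunE; apply/negbTE/loopless_connect.
have sT : locally_constant T \subset locally_constant (T :\ b).
  by apply: locally_constantS; exact: finset.subD1set.
rewrite -(finset.cardsID (locally_constant T)) (finset.setIidPr sT) mul2n -addnn; congr addn.
rewrite -[RHS](finset.card_imset _ (can_inj (xorfK h))); apply: eq_card => f.
have hT : h \in locally_constant (T :\ b) by exact: component_locally_constant.
rewrite finset.in_setD; apply/idP/finset.imsetP => [/andP[fT fb]|[g gT ->]].
  exists (xorf h f); last by rewrite xorfK.
  rewrite -(finset.setD1K bT) locally_constantU1 ?locally_constant_xor// !xorfE hb1 hb2.
  apply: contraNeq fT => fT; rewrite -(finset.setD1K bT).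
  by apply: locally_constantU1 => //; move: fT; case: (f b.1); case: (f _).
have gTb := fintype.subsetP sT _ gT.
apply/andP; split; last exact: locally_constant_xor.
apply/negP => /locally_constantP/(_ _ bT).
rewrite !xorfE hb1 hb2; move/locally_constantP : gT => /(_ _ bT) ->.
by case: (g _).
Qed.

(** Each removal of a bond doubles the count, down to the empty set, which allows all 2^(L^d)
    functions. In exponents this is the Euler relation of a forest: components = sites - bonds. *)
Lemma card_locally_constant T : loopless T ->
  (#|locally_constant T| * 2 ^ #|T| = 2 ^ (L ^ d))%N.
Proof.
have [n] := ubnP #|T|; elim: n T => // n IH T Tn lT.
have [->|[b bT]] := finset.set_0Vmem T.
  have -> : locally_constant finset.set0 = [set: _]%SET.
    apply/finset.setP => f; rewrite finset.in_setT.
    by apply/locally_constantP => b; rewrite finset.in_set0.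
  by rewrite finset.cards0 muln1 finset.cardsT card_ffun card_bool card_ffun !card_ord.
have := finset.cardsD1 b T; rewrite bT add1n => Tb.
rewrite Tb expnS mulnA [(_ * 2)%N]mulnC -(card_locally_constantD1 lT bT) IH//.
  by rewrite -ltnS -Tb.
by apply: looplessS lT; exact: finset.subD1set.
Qed.

(** A function constant along T that differs at the ends of a free bond b shows that b joins two
    components of T. Then b could be added without creating a loop, against maximality. *)
Lemma maximal_tree_locally_constant T : maximal_tree T ->
  locally_constant T \subset locally_constant (bonds d L Free).
Proof.
move=> /maxsetP[/andP[TF lT] Tmax]; apply/fintype.subsetP => f fT.
apply/locally_constantP => b bF; apply/eqP/negPn/negP => fb.
have bT : b \notin T.
  by apply/negP => bT; move/locally_constantP: fT fb => /(_ _ bT) ->; rewrite eqxx.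
suff lbT : loopless (b |: T).
  have /Tmax E : (b |: T \subset bonds d L Free) && loopless (b |: T).
    by rewrite finset.subUset finset.sub1set bF TF.
  by move: bT; rewrite -E ?finset.setU11// finset.subsetUr.
apply/forall_inP => c; rewrite finset.in_setU1 => /predU1P[->|cT].
  by rewrite finset.setU1K//; apply/negP => /(locally_constant_connect fT)/eqP; exact/negP.
(* For an old bond c, a loop through c is excluded by a function k that is constant along all other
   bonds of [b |: T] but not along c. *)
have cb : c != b by apply: contraNneq bT => <-.
apply/negP; rewrite finset.setDUl (_ : [set b]%SET :\ c = [set b]%SET); last first.
  apply/finset.setP => e; rewrite !finset.inE.
  by case: (eqVneq e c) => [->|//]; rewrite (negbTE cb).
pose h := component (T :\ c) c.1.
have hT : h \in locally_constant (T :\ c) by exact: component_locally_constant.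
(* correct h by f, if needed, to make it constant along b as well *)
pose k := if h b.1 == h (shift b.2 b.1) then h else xorf f h.
have fTc : f \in locally_constant (T :\ c).
  by apply: (fintype.subsetP (locally_constantS _)) fT; exact: finset.subD1set.
have kT : k \in locally_constant (b |: (T :\ c)).
  rewrite /k; case: ifPn => hb; apply: locally_constantU1 => //; first exact/eqP.
    exact: locally_constant_xor.
  by rewrite !xorfE; move: hb fb; case: (h b.1); case: (h _); case: (f b.1); case: (f _).
move=> /(locally_constant_connect kT); rewrite /k.
have fc : f c.1 = f (shift c.2 c.1) by move/locally_constantP : fT; apply.
have hc : h c.1 != h (shift c.2 c.1).
  by rewrite !ffunE connect0; apply: contra (loopless_connect lT cT) => /eqP <-.
case: ifP => _ /eqP; first exact/negP.
by rewrite !xorfE fc; move: hc; case: (f _); case: (h _); case: (h _).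
Qed.

End SpanningTrees.

(** * The comb and the number of retained bonds *)

Section Comb.
Local Open Scope nat_scope.
Variables d L : nat.
Implicit Types (x y : site d L) (mu nu : 'I_d) (b : bond d L).

Definition unshift mu x : site d L :=
  [ffun nu => if nu == mu then ord_pred (x nu) else x nu].

Lemma shiftK mu : cancel (shift mu) (@unshift mu).
Proof.
by move=> x; apply/ffunP => nu; rewrite !ffunE; case: eqP => // _; rewrite ordSK.
Qed.

Lemma unshiftK mu : cancel (@unshift mu) (shift mu).
Proof.
by move=> x; apply/ffunP => nu; rewrite !ffunE; case: eqP => // _; rewrite ord_predK.
Qed.

Lemma shift_comm mu nu x : shift mu (shift nu x) = shift nu (shift mu x).
Proof.
by apply/ffunP => k; rewrite !ffunE; case: eqVneq => // ->; case: eqVneq.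
Qed.

Lemma unshift_nat mu x : x mu != 0 :> nat -> unshift mu x mu = (x mu).-1 :> nat.
Proof.
rewrite ffunE eqxx /= -lt0n => xmu; rewrite -subn1 addnC -addnBA// modnDl subn1.
by rewrite modn_small// (leq_ltn_trans (leq_pred _)).
Qed.

Lemma unshift_neq mu nu x : nu != mu -> unshift mu x nu = x nu.
Proof. by rewrite ffunE => /negbTE ->. Qed.

Lemma unshift_free mu x : x mu != 0 :> nat -> (unshift mu x, mu) \in bonds d L Free.
Proof. by move=> xmu; rewrite inE /= unshift_nat// prednK ?lt0n. Qed.

Lemma shift_nat mu x : (x, mu) \in bonds d L Free -> shift mu x mu = (x mu).+1 :> nat.
Proof. by rewrite inE /= ffunE eqxx /= => ?; rewrite modn_small. Qed.

(** The l1 distance to the origin, which drops by one at each step of the descent along the comb. *)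
Definition height x : nat := \sum_nu x nu.

Lemma height_unshift mu x : x mu != 0 :> nat -> height x = (height (unshift mu x)).+1.
Proof.
move=> xmu; rewrite /height (bigD1 mu)//= [in RHS](bigD1 mu)//= unshift_nat//.
rewrite -addSn prednK ?lt0n//; congr addn.
by apply: eq_bigr => nu numu; rewrite unshift_neq.
Qed.

(** The comb enters x along this direction. Its uniqueness gives each site other than the origin
    exactly one parent, [unshift mu x]. *)
Definition leading x mu : bool :=
  (x mu != 0 :> nat) && [forall nu : 'I_d, (nu < mu) ==> (x nu == 0 :> nat)].

Lemma leading_inj x mu nu : leading x mu -> leading x nu -> mu = nu.
Proof.
move=> /andP[xmu /forallP xlt] /andP[xnu /forallP xlt']; apply/val_inj => /=.
case: (ltngtP mu nu) => // [lt|lt].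
  by move: (xlt' mu); rewrite lt (negbTE xmu).
by move: (xlt nu); rewrite lt (negbTE xnu).
Qed.

Lemma exists_leading x : height x != 0 -> exists mu, leading x mu.
Proof.
move=> hx; have [i0 xi0] : exists i, x i != 0 :> nat.
  apply/existsP; apply: contraNT hx; rewrite negb_exists => /forallP x0.
  by rewrite /height sum_nat_eq0; apply/forallP => i; have := x0 i; rewrite negbK.
case: (arg_minnP (P := fun i => x i != 0 :> nat) (fun i : 'I_d => i : nat) xi0) => mu xmu mumin.
exists mu; rewrite /leading xmu; apply/forallP => nu; apply/implyP; apply: contraTT.
by move=> /mumin; rewrite -leqNgt.
Qed.

Definition comb : {set bond d L} :=
  [set b in bonds d L Free | leading (shift b.2 b.1) b.2].

Lemma comb_sub : comb \subset bonds d L Free.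
Proof. by apply/fintype.subsetP => b; rewrite inE => /andP[]. Qed.

Lemma leading_comb x mu : leading x mu -> (unshift mu x, mu) \in comb.
Proof.
by move=> xmu; rewrite inE /= unshiftK xmu unshift_free//; case/andP: xmu.
Qed.

(** The head of a free bond has a nonzero coordinate mu, so the bond can only miss the comb through
    a smaller nonzero direction. The upper bound steps back along that direction to find a
    plaquette. *)
Lemma free_notin_comb x mu : (x, mu) \in bonds d L Free :\: comb ->
  exists2 nu : 'I_d, nu < mu & x nu != 0 :> nat.
Proof.
rewrite finset.in_setD => /andP[+ bF]; rewrite inE bF /= /leading shift_nat//=.
rewrite negb_forall => /existsP[nu]; rewrite negb_imply => /andP[numu].
rewrite ffunE; case: (eqVneq nu mu) => [E|_ xnu]; last by exists nu.
by rewrite E ltnn in numu.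
Qed.

(** Sending a comb bond to its head is a bijection onto the sites other than the origin. *)
Lemma card_comb : 0 < L -> #|comb| = (L ^ d).-1.
Proof.
move=> L0; pose o : site d L := [ffun=> Ordinal L0].
have ho : forall x, (height x == 0) = (x == o).
  move=> x; rewrite /height sum_nat_eq0; apply/forallP/eqP => [x0|->].
    by apply/ffunP => i; apply/val_inj => /=; rewrite ffunE; apply/eqP; have := x0 i.
  by move=> i; rewrite ffunE.
have -> : (L ^ d).-1 = #|[set~ o]%SET| by rewrite finset.cardsC1 card_ffun !card_ord.
have inj : {in comb &, injective (fun b : bond d L => shift b.2 b.1)}.
  move=> [x mu] [y nu]; rewrite !inE /= => /andP[_ xl] /andP[_ yl] E.
  rewrite E in xl; have Emu := leading_inj xl yl; rewrite Emu in E *.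
  by rewrite (can_inj (@shiftK nu) E).
rewrite -(finset.card_in_imset inj); apply: eq_card => y; rewrite !inE -ho.
apply/finset.imsetP/idP => [[[x mu]]|].
  rewrite inE /= => /andP[bF /andP[sx _] ->]; rewrite /height sum_nat_eq0.
  by apply/forallPn; exists mu.
move=> /exists_leading[mu ymu]; exists (unshift mu y, mu); first exact: leading_comb.
by rewrite unshiftK.
Qed.

(** Every site descends to the origin along free bonds, one unit of height at a time. *)
Lemma locally_constant_free (f : {ffun site d L -> bool}) x y :
  f \in locally_constant (bonds d L Free) -> f x = f y.
Proof.
move=> /locally_constantP fF.
have L0 : 0 < d -> 0 < L by case: d x => // d' x _; exact: leq_ltn_trans (ltn_ord (x ord0)).
have H n : forall x y, height x = n -> height y = 0 -> f x = f y.
  elim: n => [|n IH] {}x {}y hx hy.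
    congr (f _); apply/ffunP => i; apply/val_inj => /=.
    move/eqP : hx; rewrite /height sum_nat_eq0 => /forallP/(_ i)/eqP ->.
    by move/eqP : hy; rewrite /height sum_nat_eq0 => /forallP/(_ i)/eqP ->.
  have [mu xmu] : exists mu, leading x mu by apply: exists_leading; rewrite hx.
  have xmu0 : x mu != 0 :> nat by case/andP: xmu.
  rewrite -(IH (unshift mu x) y)//.
    by rewrite (fF _ (unshift_free xmu0)) /= unshiftK.
  by apply/eqP; rewrite -eqSS -height_unshift// hx.
(* In dimension 0 there is a single site; L may then be 0, so the origin [o] is built only for d >
   0. *)
case: (posnP d) => [d0|d0].
  by congr (f _); apply/ffunP => i; have := ltn_ord i; rewrite [X in _ < X]d0.
pose o : site d L := [ffun=> Ordinal (L0 d0)].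
have ho : height o = 0.
  by apply/eqP; rewrite /height sum_nat_eq0; apply/forallP => i; rewrite ffunE.
by rewrite (H _ x o erefl ho) (H _ y o erefl ho).
Qed.

(** Only the two constant functions are constant along T, so [card_locally_constant] reads 2^(#|T| +
    1) = 2^(L^d). *)
Lemma card_maximal_tree (T : {set bond d L}) : 0 < L -> maximal_tree T ->
  #|T| = (L ^ d).-1.
Proof.
move=> L0 mT.
have lT : loopless T by case/maxsetP: mT => /andP[].
have := card_locally_constant lT.
suff -> : #|locally_constant T| = 2.
  rewrite -expnS => /eqP; rewrite eqn_exp2l// => /eqP <-//.
pose o : site d L := [ffun=> Ordinal L0].
have -> : locally_constant T = [set [ffun=> c] | c in [set: bool]%SET]%SET.
  apply/finset.setP => f; apply/idP/finset.imsetP => [fT|[c _ ->]].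
    exists (f o) => //; apply/ffunP => x; rewrite ffunE.
    by apply: locally_constant_free; exact: (fintype.subsetP (maximal_tree_locally_constant mT)).
  by apply/locally_constantP => b _; rewrite !ffunE.
rewrite finset.card_imset ?finset.cardsT ?card_bool// => c c' /ffunP/(_ o).
by rewrite !ffunE.
Qed.

(** Only the number of bonds of T enters [Lambda_r], and the comb has the same number; hence the
    bounds can be proved with the comb for every T. *)
Lemma Lambda_rE (T : {set bond d L}) : 0 < L -> maximal_tree T ->
  Lambda_r T = #|bonds d L Free :\: comb|.
Proof.
move=> L0 mT; rewrite /Lambda_r !finset.cardsD (finset.setIidPr comb_sub).
have TF : T \subset bonds d L Free by case/maxsetP: mT => /andP[].
by rewrite (finset.setIidPr TF) card_comb// (card_maximal_tree L0 mT).
Qed.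

Lemma card_bonds_periodic : 0 < L ->
  #|bonds d L Periodic :\: bonds d L Free| = Lambda_e d L.
Proof.
move=> L0; have Lp : L.-1 < L by rewrite prednK.
(* An extra bond in direction mu starts at a site whose coordinate mu is L - 1, the other
   coordinates being arbitrary. *)
pose F mu nu : {pred 'I_L} := if nu == mu then pred1 (Ordinal Lp) else predT.
have cF mu : #|family (F mu)| = L ^ d.-1.
  rewrite card_family foldrE big_image /=.
  rewrite (bigD1 mu)//= {1}/F eqxx card1 mul1n.
  rewrite (eq_bigr (fun=> L)) => [|nu /negbTE numu]; last by rewrite /F numu card_ord.
  by rewrite prod_nat_const cardC1 card_ord.
rewrite -sum1_card /=.
rewrite (eq_bigl (fun b : bond d L => b.1 \in family (F b.2))); last first.
  move=> [x mu] /=; rewrite !inE andbT -leqNgt.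
  apply/idP/familyP => [xmu nu|/(_ mu)].
    rewrite /F; case: eqVneq => // ->; rewrite inE; apply/eqP/val_inj => /=.
    by apply/eqP; rewrite eqn_leq -ltnS prednK// ltn_ord -ltnS prednK.
  by rewrite /F eqxx inE => /eqP ->; rewrite /= prednK.
rewrite -(pair_big_dep xpredT (fun x mu => x \in family (F mu)) (fun _ _ => 1)) /=.
rewrite (exchange_big_dep xpredT)//= (eq_bigr (fun=> L ^ d.-1)).
  by rewrite sum_nat_const card_ord.
by move=> mu _; rewrite sum1_card cF.
Qed.

Lemma card_retained_periodic (T : {set bond d L}) : 0 < L -> maximal_tree T ->
  #|bonds d L Periodic :\: comb| = Lambda_r T + Lambda_e d L.
Proof.
move=> L0 mT; rewrite (Lambda_rE L0 mT) -card_bonds_periodic//.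
have cE := subset_leq_card comb_sub.
rewrite !finset.cardsD (finset.setIidPr comb_sub).
rewrite !(finset.setIidPr (finset.subsetT _)).
have := subset_leq_card (finset.subsetT (bonds d L Free)); rewrite /=.
move: cE; move: #|_| #|_| #|_| => c f t cf ft.
by rewrite -[in RHS]addnC addnBA// subnK.
Qed.

End Comb.

(** * Integration over tuples of independent variables *)

Lemma integral_prob_cst d (T : measurableType d) (R : realType)
  (P : probability T R) (r : \bar R) : (\int[P]_x r = r)%E.
Proof. by rewrite integral_cst//= probability_setT mule1. Qed.

Section TupleIntegral.
Context {d : measure_display} {T : measurableType d} {R : realType}.
Variable P : probability T R.
Local Open Scope ereal_scope.

Lemma integral_tuple_probS n (F : n.+1.-tuple T -> \bar R) :
  measurable_fun setT F -> (forall t, 0 <= F t) ->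
  \int[tuple_prob P n.+1]_t F t =
  \int[P]_u \int[tuple_prob P n]_t F (cons_tuple (u, t)).
Proof.
move=> mF F0.
rewrite ge0_integral_distribution// fubini_tonelli1//; last by move=> x; exact: F0.
by apply: measurableT_comp => //; exact: measurable_cons_tuple.
Qed.

Lemma measurable_cons_tuple_r n (F : n.+1.-tuple T -> \bar R) v :
  measurable_fun setT F -> measurable_fun setT (fun t => F (cons_tuple (v, t))).
Proof.
move=> mF; apply: (measurableT_comp mF).
exact: (measurableT_comp (@measurable_cons_tuple _ T n) (pair1_measurable v)).
Qed.

Definition tupd n (t : n.-tuple T) (i : 'I_n) (u : T) : n.-tuple T :=
  [tuple if j == i then u else tnth t j | j < n].

Lemma tnth_tupd n (t : n.-tuple T) i u j :
  tnth (tupd t i u) j = if j == i then u else tnth t j.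
Proof. by rewrite tnth_mktuple. Qed.

Lemma tupd_cons0 n v (t : n.-tuple T) u :
  tupd (cons_tuple (v, t)) ord0 u = cons_tuple (u, t).
Proof.
apply: eq_from_tnth => j; rewrite tnth_tupd.
by case: (unliftP ord0 j) => [k ->|->]; rewrite ?eqxx// !tnthS.
Qed.

Lemma tupd_cons_lift n v (t : n.-tuple T) (i : 'I_n) u :
  tupd (cons_tuple (v, t)) (lift ord0 i) u = cons_tuple (v, tupd t i u).
Proof.
apply: eq_from_tnth => j; rewrite tnth_tupd.
case: (unliftP ord0 j) => [k ->|->//].
by rewrite (inj_eq lift_inj) !tnthS tnth_tupd.
Qed.

Lemma measurable_tupd d' (X : measurableType d') n (f : X -> n.-tuple T) i
    (g : X -> T) :
  measurable_fun setT f -> measurable_fun setT g ->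
  measurable_fun setT (fun x => tupd (f x) i (g x)).
Proof.
move=> mf mg; apply/measurable_fun_tnthP => j.
rewrite (_ : _ \o _ = if j == i then g else (fun x => tnth (f x) j)).
  by case: ifP => // _; exact: (measurable_fun_tnthP _).1.
by apply/funext => x /=; rewrite tnth_tupd; case: ifP.
Qed.

Lemma measurable_integral_tupd n (F : n.-tuple T -> \bar R) i :
  measurable_fun setT F -> (forall t, 0 <= F t) ->
  measurable_fun setT (fun t => \int[P]_u F (tupd t i u)).
Proof.
move=> mF F0.
apply: (measurable_fun_fubini_tonelli_F (fun x : n.-tuple T * T => F (tupd x.1 i x.2))) => //=.
by apply: measurableT_comp => //; exact: measurable_tupd.
Qed.

(** Coordinate i is integrated out in place. The outer integral still runs over its old value, on
    which the integrand no longer depends, and P has total mass 1; no reindexing of tuples is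
    needed. *)
Lemma integral_tupd n (F : n.-tuple T -> \bar R) (i : 'I_n) :
  measurable_fun setT F -> (forall t, 0 <= F t) ->
  \int[tuple_prob P n]_t F t = \int[tuple_prob P n]_t \int[P]_u F (tupd t i u).
Proof.
elim: n F i => [F []//|n IH F i mF F0].
rewrite integral_tuple_probS// integral_tuple_probS; last 2 first.
- exact: measurable_integral_tupd.
- by move=> t; apply: integral_ge0.
case: (unliftP ord0 i) => [j ->|->].
  apply: eq_integral => v _.
  apply: (etrans (IH _ j (measurable_cons_tuple_r v mF) (fun=> F0 _))).
  by apply: eq_integral => t _; apply: eq_integral => u _; rewrite tupd_cons_lift.
pose C := \int[tuple_prob P n]_t \int[P]_u F (cons_tuple (u, t)).
transitivity (\int[P]_v C); last first.
  apply: eq_integral => v _; apply: eq_integral => t _; apply: eq_integral => u _.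
  by rewrite tupd_cons0.
rewrite integral_prob_cst.
rewrite (fubini_tonelli (fun x : T * n.-tuple T => F (cons_tuple x)))//.
by apply: measurableT_comp => //; exact: measurable_cons_tuple.
Qed.

Lemma measurable_subtuple m n (phi : 'I_m -> 'I_n) :
  measurable_fun (setT : set (n.-tuple T))
    (fun t => [tuple tnth t (phi j) | j < m] : m.-tuple T).
Proof.
apply/measurable_fun_tnthP => j.
rewrite (_ : _ \o _ = fun t : n.-tuple T => tnth t (phi j)).
  exact: measurable_tnth.
by apply/funext => t /=; rewrite tnth_mktuple.
Qed.

(** Coordinates at distinct positions are again independent with law P. Each is resampled in turn by
    [integral_tupd]; injectivity of phi keeps the other selected coordinates untouched. *)
Lemma integral_subtuple m n (phi : 'I_m -> 'I_n) (F : m.-tuple T -> \bar R) :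
  injective phi -> measurable_fun setT F -> (forall t, 0 <= F t) ->
  \int[tuple_prob P n]_t F [tuple tnth t (phi j) | j < m] =
  \int[tuple_prob P m]_t F t.
Proof.
elim: m phi F => [|m IH] phi F phiI mF F0.
  have E t : F t = F [tuple] by rewrite tuple0.
  under eq_integral do rewrite E.
  under [RHS]eq_integral do rewrite E.
  by rewrite !integral_prob_cst.
pose psi j := phi (lift ord0 j).
have tE t u : [tuple tnth (tupd t (phi ord0) u) (phi j) | j < m.+1] =
    cons_tuple (u, [tuple tnth t (psi j) | j < m]).
  apply: eq_from_tnth => j; rewrite tnth_mktuple tnth_tupd (inj_eq phiI).
  by case: (unliftP ord0 j) => [k ->|->]; rewrite ?eqxx//= tnthS tnth_mktuple.
have mG := measurableT_comp mF (measurable_subtuple phi).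
apply: (etrans (integral_tupd (phi ord0) mG (fun=> F0 _))).
pose G (x : n.-tuple T * T) := F (cons_tuple (x.2, [tuple tnth x.1 (psi j) | j < m])).
have mH : measurable_fun setT G.
  apply: (measurableT_comp mF); apply: measurable_cons; first exact: measurable_snd.
  exact: (measurableT_comp (measurable_subtuple psi) measurable_fst).
transitivity (\int[tuple_prob P n]_t \int[P]_u G (t, u)).
  by apply: eq_integral => t _; apply: eq_integral => u _; rewrite /= tE.
apply: (etrans (fubini_tonelli G mH (fun=> F0 _))).
apply: (etrans _ (esym (integral_tuple_probS mF F0))).
apply: eq_integral => u _.
apply: (etrans (IH psi _ _ (measurable_cons_tuple_r u mF) (fun=> F0 _))) => //.
by move=> j k /phiI /lift_inj.
Qed.

End TupleIntegral.

(** * The Haar measure of U(N) *)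

Section ComplexNorm.
Variable R : realType.
Implicit Types z w : R[i].

Lemma norm_le_ReIm z : `|z| <= (`|complex.Re z| + `|complex.Im z|)%:C.
Proof.
rewrite normc_def lecR -[leRHS]ger0_norm ?addr_ge0// -sqrtr_sqr ler_wsqrtr//.
rewrite sqrrD !real_normK ?num_real// lerD2r lerDl.
by rewrite mulrn_wge0// mulr_ge0.
Qed.

Lemma Im_le_norm z : `|complex.Im z|%:C <= `|z|.
Proof.
rewrite normc_def lecR -sqrtr_sqr ler_wsqrtr// lerDr sqr_ge0//.
Qed.

Lemma ReB z w : complex.Re (z - w) = complex.Re z - complex.Re w.
Proof. by case: z w => [a b] [c e]. Qed.

Lemma ImB z w : complex.Im (z - w) = complex.Im z - complex.Im w.
Proof. by case: z w => [a b] [c e]. Qed.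

End ComplexNorm.

Section UnitaryMeasurable.
Variables (R : realType) (N : nat).
Local Notation UN := (UN R N).
Local Notation mx := 'M[R[i]^o]_N.

Lemma open_mx_ball (O : set mx) (M : mx) : open O -> O M ->
  exists2 e : R, 0 < e & forall M' : mx,
    (forall i j, `|complex.Re (M i j) - complex.Re (M' i j)| < e /\
                 `|complex.Im (M i j) - complex.Im (M' i j)| < e) -> O M'.
Proof.
rewrite openE => /[apply] /nbhs_ballP[e /= e0 eO].
(* Positivity in R[i] forces the radius to be real. *)
have /andP[/eqP eI eR] : (complex.Im e == 0) && (0 < complex.Re e).
  by move: e0; rewrite ltcE.
exists (complex.Re e / 2); first by rewrite divr_gt0.
move=> M' MM'; apply: eO; split => // i j; rewrite -ball_normE /=.
apply: (le_lt_trans (norm_le_ReIm _)); rewrite ReB ImB.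
have [re im] := MM' i j.
by rewrite ltcE /= eI eqxx /= [ltRHS]splitr ltrD.
Qed.

(** A 1-Lipschitz real function of an entry is continuous, so the preimages of open rays are open.
    It is applied to the real and imaginary parts. *)
Lemma measurable_unitary_coord (p : R[i] -> R) i j :
  (forall z w, `|p z - p w|%:C <= `|z - w|) ->
  measurable_fun setT (fun U : UN => p (umx U i j)).
Proof.
move=> p_lip; apply: (measurability _ (RGenOInfty.measurableE R)).
move=> _ [_ [a ->] <-]; rewrite setTI; apply: sub_sigma_algebra.
exists [set M : mx | a < p (M i j)]; last first.
  rewrite setTI; apply/seteqP; split => U /=; rewrite in_itv/= andbT//.
rewrite openE => M /= aM; apply/nbhs_ballP; exists (p (M i j) - a)%:C => /=.
  by rewrite ltcR subr_gt0.
move=> M' [_ /(_ i j)]; rewrite -ball_normE /= => /(le_lt_trans (p_lip _ _)).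
rewrite ltcR => /ltr_normlW; lra.
Qed.

Lemma measurable_unitary_Re i j :
  measurable_fun setT (fun U : UN => complex.Re (umx U i j)).
Proof.
by apply: measurable_unitary_coord => z w; rewrite -ReB normc_ge_Re.
Qed.

Lemma measurable_unitary_Im i j :
  measurable_fun setT (fun U : UN => complex.Im (umx U i j)).
Proof.
by apply: measurable_unitary_coord => z w; rewrite -ImB Im_le_norm.
Qed.

(* The boxes with rational centers and radii 1/(n+1) form a countable base of
   the topology of the matrix space. *)
Lemma measurable_fun_unitary d (X : measurableType d) (f : X -> UN) :
  (forall i j, measurable_fun setT (fun x => complex.Re (umx (f x) i j))) ->
  (forall i j, measurable_fun setT (fun x => complex.Im (umx (f x) i j))) ->
  measurable_fun setT f.
Proof.
move=> mRe mIm.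
apply: (@measurability _ _ _ _ setT f (@unitary_open R N)) => //.
move=> _ [_ [V Vop <-] <-]; rewrite !setTI.
pose eps n : R := n.+1%:R^-1.
pose box (q : 'M[rat * rat]_N * nat) : set mx := [set M |
  forall i j, `|complex.Re (M i j) - ratr (q.1 i j).1| < eps q.2 /\
              `|complex.Im (M i j) - ratr (q.1 i j).2| < eps q.2].
(* Only boxes inside V are kept, so that their countable union is exactly the preimage of V. *)
pose F q : set X := if `[< box q `<=` V >] then [set x | box q (umx (f x))] else set0.
have mbox q : measurable [set x | box q (umx (f x))].
  rewrite (_ : [set x | _] = \bigcap_(k in [set: 'I_N * 'I_N])
    ([set x | `|complex.Re (umx (f x) k.1 k.2) - ratr (q.1 k.1 k.2).1| < eps q.2] `&`
     [set x | `|complex.Im (umx (f x) k.1 k.2) - ratr (q.1 k.1 k.2).2| < eps q.2])).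
    apply: fin_bigcap_measurable => // k _.
    have mlt (g : X -> R) r s : measurable_fun setT g ->
        measurable [set x | `|g x - r| < s].
      move=> mg; rewrite -[X in measurable X]setTI.
      rewrite (_ : [set x | _] = (fun x => `|g x - r|) @^-1` `]-oo, s[%classic).
        have : measurable_fun setT (fun x => `|g x - r|).
          by apply: measurableT_comp => //; apply: measurable_funB.
        by apply.
      by apply/seteqP; split => x /=; rewrite in_itv.
    by apply: measurableI; apply: mlt.
  apply/seteqP; split => x /=; first by move=> xb k _; exact: xb.
  by move=> xb i j; have := xb (i, j) I.
rewrite (_ : f @^-1` _ = \bigcup_q F q).
  apply: countable_bigcupT_measurable => [|q]; first exact: countableP.
  rewrite /F.
  by case: ifP => // _; exact: mbox.
apply/seteqP; split => [x /= Vfx|x [q _]]; last first.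
  by rewrite /F; case: asboolP => // qV xq; exact: qV.
have [e e0 eO] := open_mx_ball Vop Vfx.
(* A box of radius [eps n] whose center is within [eps n] of f x stays within 2 [eps n] of f x in
   each real coordinate, hence inside V. *)
have [n ne] : exists n, 2 * eps n < e.
  have e2 : 0 < e / 2 by rewrite divr_gt0.
  near \oo => n; exists n; rewrite mulrC -ltr_pdivlMr//.
  by near: n; exact: (near_infty_natSinv_lt (PosNum e2)).
have n0 : 0 < eps n by rewrite invr_gt0.
have /choice[r rP] (y : R) : exists q : rat, `|y - ratr q| < eps n.
  have /rat_in_itvoo[q] : y - eps n < y + eps n by lra.
  by rewrite in_itv/= => /andP[? ?]; exists q; rewrite ltr_distl; lra.
pose q : 'M[rat * rat]_N := \matrix_(i, j)
  (r (complex.Re (umx (f x) i j)), r (complex.Im (umx (f x) i j))).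
exists (q, n) => //; rewrite /F; case: asboolP => [_ i j|].
  by rewrite mxE /=; split; exact: rP.
case=> M Mq; apply: eO => i j; have [] := Mq i j; rewrite mxE /=.
have := rP (complex.Re (umx (f x) i j)); have := rP (complex.Im (umx (f x) i j)).
rewrite !ltr_distl; lra.
Unshelve. all: by end_near. Qed.

End UnitaryMeasurable.

Section MatrixMeasurable.
Context {R : realType} {d : measure_display} {X : measurableType d}.

(** Measurability in real coordinates: it is stable under the matrix operations, and
    [measurable_fun_unitary] leads from it back to maps into [UN]. *)
Definition mx_measurable m n (f : X -> 'M[R[i]]_(m, n)) : Prop :=
  forall i j, measurable_fun setT (fun x => complex.Re (f x i j)) /\
              measurable_fun setT (fun x => complex.Im (f x i j)).

Lemma mx_measurable_umx N (f : X -> UN R N) :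
  measurable_fun setT f -> mx_measurable (fun x => umx (f x)).
Proof.
move=> mf i j; split; first exact: (measurableT_comp (measurable_unitary_Re i j)).
exact: (measurableT_comp (measurable_unitary_Im i j)).
Qed.

Lemma Re_sum (I : finType) (F : I -> R[i]) :
  complex.Re (\sum_i F i) = \sum_i complex.Re (F i).
Proof. by elim/big_rec2: _ => // i y x _ <-; case: (F i) => a b; case: x. Qed.

Lemma Im_sum (I : finType) (F : I -> R[i]) :
  complex.Im (\sum_i F i) = \sum_i complex.Im (F i).
Proof. by elim/big_rec2: _ => // i y x _ <-; case: (F i) => a b; case: x. Qed.

Lemma ReM (z w : R[i]) : complex.Re (z * w) =
  complex.Re z * complex.Re w - complex.Im z * complex.Im w.
Proof. by case: z w => [a b] [c e]. Qed.

Lemma ImM (z w : R[i]) : complex.Im (z * w) =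
  complex.Re z * complex.Im w + complex.Im z * complex.Re w.
Proof. by case: z w => [a b] [c e]. Qed.

Lemma mx_measurableM m n p (f : X -> 'M[R[i]]_(m, n)) (g : X -> 'M[R[i]]_(n, p)) :
  mx_measurable f -> mx_measurable g -> mx_measurable (fun x => f x *m g x).
Proof.
move=> mf mg i j; split.
  rewrite (_ : (fun x => _) = fun x => \sum_k
      (complex.Re (f x i k) * complex.Re (g x k j) -
       complex.Im (f x i k) * complex.Im (g x k j))).
    apply: measurable_sum => k; have [? ?] := mf i k; have [? ?] := mg k j.
    by apply: measurable_funB; apply: measurable_funM.
  by apply/funext => x; rewrite mxE Re_sum; apply: eq_bigr => k _; rewrite ReM.
rewrite (_ : (fun x => _) = fun x => \sum_k
    (complex.Re (f x i k) * complex.Im (g x k j) +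
     complex.Im (f x i k) * complex.Re (g x k j))).
  apply: measurable_sum => k; have [? ?] := mf i k; have [? ?] := mg k j.
  by apply: measurable_funD; apply: measurable_funM.
by apply/funext => x; rewrite mxE Im_sum; apply: eq_bigr => k _; rewrite ImM.
Qed.

Lemma mx_measurable_tC m n (f : X -> 'M[R[i]]_(m, n)) :
  mx_measurable f -> mx_measurable (fun x => (f x)^t*).
Proof.
move=> mf i j; have [mr mi] := mf j i; split.
  rewrite (_ : (fun x => _) = fun x => complex.Re (f x j i))//.
  by apply/funext => x; rewrite !mxE; case: (f x j i).
rewrite (_ : (fun x => _) = fun x => - complex.Im (f x j i)).
  by apply: measurableT_comp.
by apply/funext => x; rewrite !mxE; case: (f x j i).
Qed.

Lemma measurable_Re_tr n (f : X -> 'M[R[i]]_n) : mx_measurable f ->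
  measurable_fun setT (fun x => complex.Re (\tr (f x))).
Proof.
move=> mf; rewrite (_ : (fun x => _) = fun x => \sum_k complex.Re (f x k k)).
  by apply: measurable_sum => k; have [] := mf k k.
by apply/funext => x; rewrite Re_sum.
Qed.

End MatrixMeasurable.

Section UnitaryGroup.
Variables (R : realType) (N : nat).
Local Notation UN := (UN R N).
Implicit Types U V W : UN.

Lemma umx_inj : injective (@umx R N).
Proof. exact: val_inj. Qed.

Fact uinv_subproof (U : unitary R N) : (umx U)^t* \is unitarymx.
Proof. by rewrite trmxC_unitary; exact: (svalP U). Qed.

Definition uinv (U : unitary R N) : unitary R N :=
  exist _ ((umx U)^t*) (uinv_subproof U).

Lemma umxM U V : umx (umul U V) = umx U *m umx V. Proof. by []. Qed.
Lemma umxV U : umx (uinv U) = (umx U)^t*. Proof. by []. Qed.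
Lemma umx1 : umx (uone R N) = 1%:M. Proof. by []. Qed.

Lemma mul1u U : umul (uone R N) U = U.
Proof. by apply: umx_inj; rewrite umxM umx1 mul1mx. Qed.

Lemma umulV U : umul U (uinv U) = uone R N.
Proof. by apply: umx_inj; rewrite umxM umxV umx1; apply/unitarymxP; exact: (svalP U). Qed.

Lemma mulVu U : umul (uinv U) U = uone R N.
Proof.
apply: umx_inj; rewrite umxM umxV umx1; apply: mulmx1C.
by apply/unitarymxP; exact: (svalP U).
Qed.

Lemma uinvK U : uinv (uinv U) = U.
Proof. by apply: umx_inj; rewrite !umxV trmxCK. Qed.

Lemma uinvM U V : uinv (umul U V) = umul (uinv V) (uinv U).
Proof. by apply: umx_inj; rewrite !(umxV, umxM) trmx_mul map_mxM. Qed.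

Lemma measurable_umul d (X : measurableType d) (f g : X -> UN) :
  measurable_fun setT f -> measurable_fun setT g ->
  measurable_fun setT (fun x => umul (f x) (g x) : UN).
Proof.
move=> /mx_measurable_umx mf /mx_measurable_umx mg.
have mfg := mx_measurableM mf mg.
by apply: measurable_fun_unitary => i j; have [] := mfg i j.
Qed.

Lemma measurable_uinv d (X : measurableType d) (f : X -> UN) :
  measurable_fun setT f -> measurable_fun setT (fun x => uinv (f x) : UN).
Proof.
move=> /mx_measurable_umx/mx_measurable_tC mf.
by apply: measurable_fun_unitary => i j; have [] := mf i j.
Qed.

End UnitaryGroup.

Section Haar.
Variables (R : realType) (N : nat) (sigma : probability (UN R N) R).
Hypothesis haar_sigma : is_haar sigma.
Local Notation UN := (UN R N).
Local Open Scope ereal_scope.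

Lemma haar_mulL (V : UN) (f : UN -> \bar R) :
  measurable_fun setT f -> (forall U, 0 <= f U) ->
  \int[sigma]_U f (umul V U) = \int[sigma]_U f U.
Proof.
move=> mf f0.
have mV : measurable_fun setT (umul V : UN -> UN).
  by apply: measurable_umul; [exact: measurable_cst|exact: measurable_id].
rewrite -[LHS](ge0_integral_pushforward mV sigma measurableT mf)//.
by apply: eq_measure_integral => A mA _; exact: haar_sigma.
Qed.

(** Integrate f(U^-1 V) over both variables. For fixed V, left invariance in U gives the integral of
    f(U^-1); for fixed U, left invariance in V gives the integral of f. Tonelli equates the two. *)
Lemma haar_inv (f : UN -> \bar R) :
  measurable_fun setT f -> (forall U, 0 <= f U) ->
  \int[sigma]_U f (uinv U) = \int[sigma]_U f U.
Proof.
move=> mf f0.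
have mfi : measurable_fun setT (fun U : UN => f (uinv U)).
  apply: (measurableT_comp mf); apply: measurable_uinv; exact: measurable_id.
pose F (x : UN * UN) := f (umul (uinv x.2) x.1).
have mF : measurable_fun setT F.
  apply: (measurableT_comp mf); apply: measurable_umul; last exact: measurable_fst.
  by apply: measurable_uinv; exact: measurable_snd.
transitivity (\int[sigma]_V \int[sigma]_U F (V, U)).
  rewrite -[LHS](integral_prob_cst sigma); apply: eq_integral => V _.
  rewrite -(haar_mulL (uinv V) mfi)//; apply: eq_integral => U _.
  by rewrite /F /= uinvM uinvK.
apply: (etrans (fubini_tonelli F mF (fun=> f0 _))).
rewrite -[RHS](integral_prob_cst sigma).
by apply: eq_integral => U _; rewrite -(haar_mulL (uinv U) mf).
Qed.

(** Right translation by V is left translation by V^-1 conjugated by inversion. *)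
Lemma haar_mulR (V : UN) (f : UN -> \bar R) :
  measurable_fun setT f -> (forall U, 0 <= f U) ->
  \int[sigma]_U f (umul U V) = \int[sigma]_U f U.
Proof.
move=> mf f0.
have mfi : measurable_fun setT (fun U : UN => f (uinv U)).
  apply: (measurableT_comp mf); apply: measurable_uinv; exact: measurable_id.
have mfV : measurable_fun setT (fun U : UN => f (umul U V)).
  apply: (measurableT_comp mf).
  by apply: measurable_umul; [exact: measurable_id|exact: measurable_cst].
rewrite -haar_inv// -[RHS]haar_inv// -[RHS](haar_mulL (uinv V))//.
by apply: eq_integral => U _; rewrite uinvM uinvK.
Qed.

End Haar.

(** * Gauge fixing *)

Section Configurations.
Variables (R : realType) (N d L : nat) (B : boundary).
Local Notation UN := (UN R N).
Local Notation config := (config R N d L B).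
Local Notation bond := (bond d L).
Local Notation bonds := (bonds d L B).
Implicit Types (U : config) (b c : bond) (u : UN) (V W : bond -> UN).

(** The group element behind the matrix [link U b], which is [umx (gvar U b)] by conversion. *)
Definition gvar U b : UN := nth (uone R N) U (index b (enum bonds)).

Lemma index_bonds b : (index b (enum bonds) < #|bonds|)%N = (b \in bonds).
Proof. by rewrite cardE index_mem mem_enum. Qed.

Lemma gvar_notin U b : b \notin bonds -> gvar U b = uone R N.
Proof. by move=> bB; rewrite /gvar nth_default// size_tuple leqNgt index_bonds. Qed.

Lemma gvar_in U b (bB : b \in bonds) :
  gvar U b = tnth U (Ordinal (etrans (index_bonds b) bB)).
Proof. by rewrite /gvar (tnth_nth (uone R N)). Qed.

Definition bupd U b u : config :=
  [tuple if j == index b (enum bonds) :> nat then u else tnth U j | j < #|bonds|].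

Lemma gvar_bupd U b u c : b \in bonds ->
  gvar (bupd U b u) c = if c == b then u else gvar U c.
Proof.
move=> bB; have [cB|cB] := boolP (c \in bonds); last first.
  by rewrite !gvar_notin//; case: eqP bB cB => // -> ->.
rewrite !(gvar_in _ cB) tnth_mktuple /=.
rewrite (_ : (_ == _ :> nat) = (c == b))//.
apply/eqP/eqP => [E|->//].
by rewrite -(nth_index c (s := enum bonds) (x := c)) ?mem_enum// E nth_index ?mem_enum.
Qed.

Lemma eq_config U U' : (forall b, b \in bonds -> gvar U b = gvar U' b) -> U = U'.
Proof.
move=> E; apply: eq_from_tnth => j.
have jB : enum_val j \in bonds by exact: enum_valP.
have := E _ jB; rewrite !(gvar_in _ jB).
suff -> : Ordinal (etrans (index_bonds (enum_val j)) jB) = j by [].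
apply: val_inj => /=; rewrite (enum_val_nth (enum_val j)) index_uniq ?enum_uniq//.
by rewrite -cardE.
Qed.

Definition mkconfig V : config := [tuple V (enum_val j) | j < #|bonds|].

Lemma gvar_mkconfig V b : b \in bonds -> gvar (mkconfig V) b = V b.
Proof.
move=> bB; rewrite (gvar_in _ bB) tnth_mktuple; congr V.
by rewrite (enum_val_nth b) nth_index// mem_enum.
Qed.

Lemma measurable_gvar b : measurable_fun setT (fun U : config => gvar U b).
Proof.
have [bB|bB] := boolP (b \in bonds); last first.
  rewrite (_ : (fun U => _) = cst (uone R N : UN)); first exact: measurable_cst.
  by apply/funext => U; rewrite gvar_notin.
rewrite (_ : (fun U => _) = (fun U : config => tnth U (Ordinal (etrans (index_bonds b) bB)))).
  exact: measurable_tnth.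
by apply/funext => U; rewrite (gvar_in _ bB).
Qed.

Lemma measurable_mkconfig d' (X : measurableType d') (f : X -> bond -> UN) :
  (forall b, b \in bonds -> measurable_fun setT (f ^~ b)) ->
  measurable_fun setT (fun x => mkconfig (f x)).
Proof.
move=> mf; apply/measurable_fun_tnthP => j.
rewrite (_ : _ \o _ = f ^~ (enum_val j)); first by apply: mf; exact: enum_valP.
by apply/funext => x /=; rewrite tnth_mktuple.
Qed.

Lemma bupd_tupd U b u (bB : b \in bonds) :
  bupd U b u = tupd U (Ordinal (etrans (index_bonds b) bB)) u.
Proof. by apply: eq_from_tnth => j; rewrite [LHS]tnth_mktuple [RHS]tnth_tupd. Qed.

Lemma measurable_bupd d' (X : measurableType d') (f : X -> config) b (g : X -> UN) :
  b \in bonds -> measurable_fun setT f -> measurable_fun setT g ->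
  measurable_fun setT (fun x => bupd (f x) b (g x)).
Proof.
move=> bB mf mg; rewrite (_ : (fun x => _) = fun x =>
  tupd (f x) (Ordinal (etrans (index_bonds b) bB)) (g x)).
  exact: measurable_tupd.
by apply/funext => x; rewrite bupd_tupd.
Qed.

Lemma bupd_bupd U b u v : bupd (bupd U b u) b v = bupd U b v.
Proof.
by apply: eq_from_tnth => j; rewrite [LHS]tnth_mktuple [RHS]tnth_mktuple;
  case: ifP => // jb; rewrite tnth_mktuple jb.
Qed.

Variable sigma : probability UN R.
Local Notation mu := (tuple_prob sigma #|bonds|).
Local Open Scope ereal_scope.

Lemma integral_bupd (F : config -> \bar R) b : b \in bonds ->
  measurable_fun setT F -> (forall U, 0 <= F U) ->
  \int[mu]_U F U = \int[mu]_U \int[sigma]_u F (bupd U b u).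
Proof.
move=> bB mF F0.
apply: (etrans (integral_tupd sigma (Ordinal (etrans (index_bonds b) bB)) mF F0)).
by apply: eq_integral => U _; apply: eq_integral => u _; rewrite bupd_tupd.
Qed.

Definition indep_of T (W : config -> T) b := forall U u, W (bupd U b u) = W U.

Hypothesis haar_sigma : is_haar sigma.

(** With the other variables frozen, G U and H U are constants, and the substitution is a two-sided
    translation of the variable b. *)
Lemma integral_shear (F : config -> \bar R) b (G H : config -> UN) :
  b \in bonds -> measurable_fun setT F -> (forall U, 0 <= F U) ->
  measurable_fun setT G -> measurable_fun setT H ->
  indep_of G b -> indep_of H b ->
  \int[mu]_U F (bupd U b (umul (umul (G U) (gvar U b)) (H U))) = \int[mu]_U F U.
Proof.
move=> bB mF F0 mG mH Gb Hb.
set F' := fun U => _.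
have mF' : measurable_fun setT F'.
  apply: (measurableT_comp mF); apply: measurable_bupd => //.
  by apply: measurable_umul => //; apply: measurable_umul => //; exact: measurable_gvar.
rewrite (integral_bupd bB mF' (fun=> F0 _)) [RHS](integral_bupd bB mF F0).
apply: eq_integral => U _.
have mFU : measurable_fun setT (fun u : UN => F (bupd U b u)).
  apply: (measurableT_comp mF); exact: measurable_bupd.
rewrite -[RHS](haar_mulR haar_sigma (H U) mFU (fun=> F0 _)).
have mFUR : measurable_fun setT (fun u : UN => F (bupd U b (umul u (H U)))).
  apply: (measurableT_comp mFU).
  by apply: measurable_umul; [exact: measurable_id|exact: measurable_cst].
rewrite -[RHS](haar_mulL haar_sigma (G U) mFUR (fun=> F0 _)).
apply: eq_integral => u _.
by rewrite /F' Gb Hb gvar_bupd// eqxx bupd_bupd.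
Qed.

(** The bonds of S are integrated in order of decreasing r. The bond of largest rank occurs in no W,
    hence only in its own factor, and left invariance turns that factor into the one-bond integral
    whatever the remaining variables are. *)
Lemma integral_peel (S : {set bond}) (r : bond -> nat) (h : UN -> R)
    (W : bond -> config -> UN) :
  S \subset bonds -> measurable_fun setT h -> (forall u, (0 <= h u)%R) ->
  (forall b, b \in S -> measurable_fun setT (W b)) ->
  {in S &, forall b c, (r b <= r c)%N -> indep_of (W b) c} ->
  \int[mu]_U (\prod_(b in S) h (umul (W b U) (gvar U b)))%:E =
  (\int[sigma]_u (h u)%:E) ^+ #|S|.
Proof.
move=> + mh h0; have [n] := ubnP #|S|; elim: n S => // n IH S Sn SB mW indW.
have [->|[b0 b0S]] := finset.set_0Vmem S.
  under eq_integral do rewrite finset.big_set0.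
  by rewrite integral_prob_cst finset.cards0.
(* The bond b of maximal rank is integrated first; [rest] does not depend on it. *)
case: (arg_maxnP r b0S) => b bS bmax.
have bB := fintype.subsetP SB _ bS.
pose S' := (S :\ b)%SET.
have SS' : #|S| = #|S'|.+1 by rewrite (finset.cardsD1 b S) (bS : b \in S) add1n.
have S'S : S' \subset S by exact: finset.subD1set.
pose rest (U : config) := (\prod_(c in S') h (umul (W c U) (gvar U c)))%R.
have rest0 U : (0 <= rest U)%R by apply: prodr_ge0.
have mhW c : c \in S -> measurable_fun setT (fun U => h (umul (W c U) (gvar U c))).
  move=> cS; apply: (measurableT_comp mh); apply: measurable_umul; first exact: mW.
  exact: measurable_gvar.
have mrest : measurable_fun setT rest.
  rewrite /rest; under eq_fun do rewrite -big_enum /=.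
  by apply: measurable_prod => c; rewrite mem_enum => /(fintype.subsetP S'S); exact: mhW.
have E U : (\prod_(c in S) h (umul (W c U) (gvar U c)) =
    h (umul (W b U) (gvar U b)) * rest U)%R by rewrite (finset.big_setD1 b).
have restb : indep_of rest b.
  move=> U u; apply: eq_bigr => c; rewrite finset.in_setD1 => /andP[cb cS].
  by rewrite gvar_bupd// (negbTE cb) indW//; exact: bmax.
under eq_integral do rewrite E.
rewrite (integral_bupd bB); last 2 first.
- by apply/measurable_EFinP; apply: measurable_funM => //; exact: mhW.
- by move=> U; rewrite lee_fin mulr_ge0.
have IHS : \int[mu]_U (rest U)%:E = (\int[sigma]_u (h u)%:E) ^+ #|S'|.
  apply: IH; first by rewrite -ltnS -SS'.
  - exact: fintype.subset_trans S'S SB.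
  - by move=> c cS'; apply: mW; exact: fintype.subsetP cS'.
  - by move=> c e /(fintype.subsetP S'S) cS /(fintype.subsetP S'S) eS; exact: indW.
have z0 : 0 <= \int[sigma]_u (h u)%:E by apply: integral_ge0 => u _; rewrite lee_fin.
rewrite SS' expeS -IHS -ge0_integralZl//; last 2 first.
- exact/measurable_EFinP.
- by move=> U _; rewrite lee_fin.
apply: eq_integral => U _.
have mhL : measurable_fun setT (fun u => (h u)%:E) by exact/measurable_EFinP.
rewrite -(haar_mulL haar_sigma (W b U) mhL (fun=> h0 _)).
have mhW' : measurable_fun setT (fun u : UN => (h (umul (W b U) u))%:E).
  apply/measurable_EFinP; apply: (measurableT_comp mh).
  by apply: measurable_umul; [exact: measurable_cst|exact: measurable_id].
have restE : 0 <= (rest U)%:E by rewrite lee_fin.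
rewrite muleC -(ge0_integralZl sigma measurableT mhW' (fun u _ => h0 _) restE).
apply: eq_integral => u _.
by rewrite restb gvar_bupd// eqxx indW// EFinM muleC.
Qed.

End Configurations.

Lemma trmxC_mul (C : numClosedFieldType) m n p (A : 'M[C]_(m, n)) (B : 'M[C]_(n, p)) :
  (A *m B)^t* = B^t* *m A^t*.
Proof. by rewrite trmx_mul map_mxM. Qed.

Section GaugeFixing.
Variables (R : realType) (N d L : nat) (B : boundary).
Local Notation UN := (UN R N).
Local Notation config := (config R N d L B).
Local Notation site := (site d L).
Local Notation bond := (bond d L).
Local Notation bonds := (bonds d L B).
Local Notation comb := (@comb d L).
Implicit Types (U : config) (b c : bond) (x : site) (V W : bond -> UN).

(* Ordered product of the link variables of the comb along its path from the
   origin to x; [n] is fuel. *)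
Fixpoint gauge_rec n x U : UN :=
  if n is n'.+1 then
    if [pick mu | leading x mu] is Some mu
    then umul (gauge_rec n' (unshift mu x) U) (gvar U (unshift mu x, mu))
    else uone R N
  else uone R N.

Definition gauge x U : UN := gauge_rec (height x) x U.

Lemma gauge_comb x mu U : (x, mu) \in comb ->
  gauge (shift mu x) U = umul (gauge x U) (gvar U (x, mu)).
Proof.
rewrite inE /= => /andP[_ l]; have s0 : shift mu x mu != 0 :> nat by case/andP: l.
rewrite /gauge (height_unshift s0) /= shiftK; case: pickP => [nu l'|/(_ mu)].
  by rewrite (leading_inj l' l) shiftK.
by rewrite l.
Qed.

Lemma measurable_gauge x : measurable_fun setT (gauge x).
Proof.
rewrite /gauge; move: (height x) => n; elim: n x => [|n IH] x /=; first exact: measurable_cst.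
case: pickP => [mu _|_]; last exact: measurable_cst.
by apply: measurable_umul => //; exact: measurable_gvar.
Qed.

(** The path from the origin to x uses comb bonds only. *)
Lemma gauge_indep x c : c \in bonds :\: comb -> indep_of (gauge x) c.
Proof.
rewrite finset.in_setD => /andP[cC cB] U u.
rewrite /gauge; move: (height x) => n; elim: n x => //= n IH x.
case: pickP => // mu l; rewrite IH gvar_bupd//; case: eqP => // E.
by case/negP: cC; rewrite -E leading_comb.
Qed.

Definition gauge_transform U b : UN :=
  umul (umul (gauge b.1 U) (gvar U b)) (uinv (gauge (shift b.2 b.1) U)).

Lemma measurable_gauge_transform b : measurable_fun setT (gauge_transform ^~ b).
Proof.
apply: measurable_umul; last by apply: measurable_uinv; exact: measurable_gauge.
by apply: measurable_umul; [exact: measurable_gauge|exact: measurable_gvar].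
Qed.

Lemma gauge_transform_comb U b : b \in comb -> gauge_transform U b = uone R N.
Proof.
by case: b => x mu bC; rewrite /gauge_transform /= (gauge_comb _ bC) umulV.
Qed.

Definition plaq V (p : plaquette d L) : 'M[R[i]]_N :=
  umx (V (b1 p)) *m umx (V (b2 p)) *m (umx (V (b3 p)))^t* *m (umx (V (b4 p)))^t*.

Lemma plaquette_action_conj (G : UN) (A : 'M[R[i]]_N) :
  plaquette_action (umx G *m A *m (umx G)^t*) = plaquette_action A.
Proof.
rewrite /plaquette_action; congr (2 * complex.Re _).
have GG : (umx G)^t* *m umx G = 1%:M by rewrite -(umxV G) -umxM mulVu.
by rewrite !linearB /= mxtrace_mulC mulmxA GG mul1mx.
Qed.

(** The gauge factors cancel at the three other corners, which leaves a conjugation by the gauge at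
    the base point x. [shift_comm] identifies the far corner as reached from both sides. *)
Lemma plaquette_action_gauge U p :
  plaquette_action (plaq (gauge_transform U) p) = plaquette_action (plaq (gvar U) p).
Proof.
case: p => -[x mu] nu; rewrite -[RHS](plaquette_action_conj (gauge x U)).
congr plaquette_action; rewrite /plaq /= /gauge_transform /=.
have GK y (A : 'M[R[i]]_N) : A *m (umx (gauge y U))^t* *m umx (gauge y U) = A.
  by rewrite -mulmxA -(umxV (gauge y U)) -umxM mulVu umx1 mulmx1.
by rewrite !trmxC_mul !trmxCK (shift_comm mu nu) !mulmxA !GK.
Qed.

Definition total_action V : R :=
  \sum_(p in plaquettes d L B) plaquette_action (plaq V p).

Lemma total_action_ext V W : (forall b, b \in bonds -> V b = W b) ->
  total_action V = total_action W.
Proof.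
move=> VW; apply: eq_bigr => p.
by rewrite inE /plaq => /and5P[_ *]; rewrite !VW.
Qed.

Lemma total_action_gauge U : total_action (gauge_transform U) = total_action (gvar U).
Proof. by apply: eq_bigr => p _; exact: plaquette_action_gauge. Qed.

Variable beta : R.

Definition boltzmann V : R := expR (- (beta * total_action V)).

Lemma mx_measurable_plaq d' (X : measurableType d') (f : X -> bond -> UN) p :
  (forall b, measurable_fun setT (f ^~ b)) ->
  mx_measurable (fun t => plaq (f t) p).
Proof.
move=> mf; have mu b := mx_measurable_umx (mf b).
have mtu b := mx_measurable_tC (mu b).
by do 3! [apply: mx_measurableM => //].
Qed.

Lemma measurable_plaquette_action d' (X : measurableType d') (f : X -> 'M[R[i]]_N) :
  mx_measurable f -> measurable_fun setT (fun t => plaquette_action (f t)).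
Proof.
move=> mf; apply: measurable_funM => //.
rewrite (_ : (fun t => _) = fun t => complex.Re (\tr (1%:M : 'M[R[i]]_N)) - complex.Re (\tr (f t))).
  by apply: measurable_funB => //; exact: measurable_Re_tr.
by apply/funext => t; rewrite linearB /= ReB.
Qed.

Lemma measurable_boltzmann d' (X : measurableType d') (f : X -> bond -> UN) :
  (forall b, measurable_fun setT (f ^~ b)) ->
  measurable_fun setT (fun t => boltzmann (f t)).
Proof.
move=> mf; apply: measurableT_comp => //; apply: measurableT_comp => //.
apply: measurable_funM => //; rewrite /total_action.
under eq_fun do rewrite -big_enum /=.
apply: measurable_sum => p; apply: measurable_plaquette_action.
exact: mx_measurable_plaq.
Qed.

Variable sigma : probability UN R.
Hypothesis haar_sigma : is_haar sigma.
Local Notation mu := (tuple_prob sigma #|bonds|).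
Local Open Scope ereal_scope.

(** The retained bonds are transformed one at a time. The gauge is a function of the comb variables
    alone, so it is unaffected by earlier transformations and each step is a shear. *)
Lemma integral_gauge_transform (s : seq bond) (F : config -> \bar R) :
  uniq s -> {subset s <= bonds :\: comb} ->
  measurable_fun setT F -> (forall U, 0 <= F U) ->
  \int[mu]_U F (mkconfig B (fun b => if b \in s then gauge_transform U b else gvar U b))
  = \int[mu]_U F U.
Proof.
move=> us sB mF F0; elim: s us sB => [|c s IH] /=.
  by move=> _ _; apply: eq_integral => U _; congr F; apply: eq_config => b bB;
    rewrite gvar_mkconfig.
move=> /andP[cs us] sB.
have cBC : c \in bonds :\: comb by apply: sB; rewrite mem_head.
have cB : c \in bonds by move: cBC; rewrite finset.in_setD => /andP[].
rewrite -IH//; last by move=> b bs; apply: sB; rewrite in_cons bs orbT.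
pose T U : config :=
  mkconfig B (fun b => if b \in s then gauge_transform U b else gvar U b).
have mT : measurable_fun setT T.
  apply: measurable_mkconfig => b _; case: (b \in s).
    exact: measurable_gauge_transform.
  exact: measurable_gvar.
have mFT : measurable_fun setT (F \o T) by exact: (measurableT_comp mF).
rewrite -[RHS](integral_shear haar_sigma cB mFT (fun=> F0 _)
  (measurable_gauge c.1) (measurable_uinv (measurable_gauge (shift c.2 c.1)))
  (gauge_indep c.1 cBC)); last by move=> U u; rewrite (gauge_indep _ cBC).
apply: eq_integral => U _; congr F; apply: eq_config => b bB.
rewrite !gvar_mkconfig// in_cons {2}/gauge_transform !(gauge_indep _ cBC) gvar_bupd//.
case: (eqVneq b c) => [->|bc] /=; first by rewrite (negbTE cs).
by [].
Qed.

Definition comb_fixed U b : UN := if b \in comb then uone R N else gvar U b.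

Lemma measurable_comb_fixed b : measurable_fun setT (comb_fixed ^~ b).
Proof.
rewrite /comb_fixed; case: (b \in comb); first exact: measurable_cst.
exact: measurable_gvar.
Qed.

(** The action does not change under the gauge transformation, which makes the comb variables
    trivial; the transformed retained variables are then replaced by the original ones at no
    cost. *)
Lemma integral_gauge_fixing :
  \int[mu]_U (boltzmann (gvar U))%:E = \int[mu]_U (boltzmann (comb_fixed U))%:E.
Proof.
have mF : measurable_fun setT (fun U => (boltzmann (comb_fixed U))%:E).
  apply/measurable_EFinP; apply: measurable_boltzmann => b.
  exact: measurable_comb_fixed.
have s_ret : {subset enum (bonds :\: comb) <= bonds :\: comb}.
  by move=> b; rewrite mem_enum.
have F0 U : 0 <= (boltzmann (comb_fixed U))%:E by rewrite lee_fin expR_ge0.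
rewrite -[RHS](integral_gauge_transform (enum_uniq _) s_ret mF F0).
apply: eq_integral => U _; rewrite /boltzmann -total_action_gauge.
set W := comb_fixed _.
suff -> : total_action (gauge_transform U) = total_action W by [].
apply: total_action_ext => b bB; rewrite /W /comb_fixed.
case: ifPn => bC; first exact: gauge_transform_comb.
by rewrite gvar_mkconfig// mem_enum finset.in_setD bC bB.
Qed.

End GaugeFixing.

(** * Bounds on the partition functions *)

Section ActionInequality.
Variables (R : realType) (N : nat).
Local Notation UN := (UN R N).
Implicit Types (A : 'M[R[i]]_N) (U V W : UN).

Definition hs2 A : R := complex.Re (\tr (A *m A^t*)).

Lemma hs2E A :
  hs2 A = \sum_i \sum_j (complex.Re (A i j) ^+ 2 + complex.Im (A i j) ^+ 2).
Proof.
rewrite /hs2 /mxtrace Re_sum; apply: eq_bigr => i _.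
rewrite mxE Re_sum; apply: eq_bigr => j _.
by rewrite !mxE; case: (A i j) => a b /=; rewrite mulrN opprK !expr2.
Qed.

Lemma hs2_ge0 A : 0 <= hs2 A.
Proof.
rewrite hs2E sumr_ge0// => i _; rewrite sumr_ge0// => j _.
by rewrite addr_ge0// sqr_ge0.
Qed.

Lemma hs2D A1 A2 : hs2 (A1 + A2) <= 2 * hs2 A1 + 2 * hs2 A2.
Proof.
rewrite !hs2E !mulr_sumr -big_split/= ler_sum// => i _.
rewrite !mulr_sumr -big_split/= ler_sum// => j _.
rewrite mxE; case: (A1 i j) => a b; case: (A2 i j) => c e /=.
have := sqr_ge0 (a - c); have := sqr_ge0 (b - e); rewrite !sqrrB !sqrrD; lra.
Qed.

Lemma hs2_unitaryM U A : hs2 (umx U *m A) = hs2 A.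
Proof.
rewrite /hs2 trmxC_mul mulmxA mxtrace_mulC !mulmxA -(umxV U) -umxM mulVu.
by rewrite umx1 mul1mx.
Qed.

Lemma trmxCB A1 A2 : (A1 - A2)^t* = A1^t* - A2^t*.
Proof. by apply/matrixP => i j; rewrite !mxE rmorphB. Qed.

Lemma mxtraceB A1 A2 : \tr (A1 - A2) = \tr A1 - \tr A2.
Proof. by rewrite linearB. Qed.

Lemma Re_conjC (z : R[i]) : complex.Re (Num.conj z) = complex.Re z.
Proof. by case: z. Qed.

Lemma Re_tr_tC A : complex.Re (\tr (A^t*)) = complex.Re (\tr A).
Proof.
by rewrite /mxtrace !Re_sum; apply: eq_bigr => i _; rewrite !mxE Re_conjC.
Qed.

(** For unitary U the product of 1 - U with its adjoint is 2 - U - U^-1, and U and U^-1 have the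
    same real part of the trace. *)
Lemma plaquette_action_hs2 U : plaquette_action (umx U) = hs2 (1%:M - umx U).
Proof.
rewrite /plaquette_action /hs2 trmxCB trmx1 map_mx1.
rewrite mulmxBl !mulmxBr !mul1mx mulmx1 -(umxV U) -umxM umulV umx1.
rewrite !mxtraceB !ReB umxV Re_tr_tC; lra.
Qed.

Lemma plaquette_action_ge0 U : 0 <= plaquette_action (umx U).
Proof. by rewrite plaquette_action_hs2 hs2_ge0. Qed.

Lemma plaquette_action1 : plaquette_action (1%:M : 'M[R[i]]_N) = 0.
Proof. by rewrite /plaquette_action subrr linear0 mulr0. Qed.

Lemma plaquette_actionV U : plaquette_action (umx (uinv U)) = plaquette_action (umx U).
Proof. by rewrite /plaquette_action !mxtraceB !ReB umxV Re_tr_tC. Qed.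

(** Writes 1 - U V = (1 - U) + U (1 - V), where left multiplication by U preserves the
    Hilbert-Schmidt norm. *)
Lemma plaquette_actionM U V : plaquette_action (umx (umul U V)) <=
  2 * plaquette_action (umx U) + 2 * plaquette_action (umx V).
Proof.
rewrite !plaquette_action_hs2 umxM.
have -> : 1%:M - umx U *m umx V = (1%:M - umx U) + umx U *m (1%:M - umx V).
  by rewrite mulmxBr mulmx1 addrA subrK.
by rewrite (le_trans (hs2D _ _))// hs2_unitaryM.
Qed.

End ActionInequality.

Lemma sum_oriented_plaquettes (R : nmodType) (d L : nat) (F : plaquette d L -> R) :
 \sum_(p : plaquette d L | (p.1.2 < p.2)%N) F p =
    \sum_(mu < d) \sum_(nu < d | (mu < nu)%N) \sum_x F (x, mu, nu).
Proof.
transitivity (\sum_(q : site d L * 'I_d) \sum_(nu < d | (q.2 < nu)%N) F (q, nu)).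
  by rewrite pair_big_dep /=; apply: eq_big => -[].
transitivity (\sum_(x : site d L) \sum_(mu < d) \sum_(nu < d | (mu < nu)%N) F (x, mu, nu)).
  by rewrite pair_bigA /=; apply: eq_bigr => -[].
by rewrite exchange_big; apply: eq_bigr => mu _; rewrite exchange_big.
Qed.

Lemma sum_bonds (R : nmodType) (d L : nat) (w : bond d L -> R) :
  \sum_b w b = \sum_(mu < d) (\sum_x w (x, mu)).
Proof.
by rewrite exchange_big /= pair_bigA /=; apply: eq_bigr => -[].
Qed.

Section TotalAction.
Variables (R : realType) (N d L : nat) (B : boundary).
Local Notation UN := (UN R N).
Local Notation bond := (bond d L).
Implicit Types (V : bond -> UN) (p : plaquette d L).

(** Each plane through the direction of a bond contributes that bond twice, once for each of the two
    parallel sides of a plaquette, and there are d - 1 such planes. *)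
Lemma sum_plaquettes_le (w : bond -> R) : (forall b, 0 <= w b) ->
  \sum_(p in plaquettes d L B) (w (b1 p) + w (b2 p) + w (b3 p) + w (b4 p)) <=
  2 * d.-1%:R * \sum_b w b.
Proof.
move=> w0; pose S mu := \sum_x w (x, mu).
pose F p := w (b1 p) + w (b2 p) + w (b3 p) + w (b4 p).
have F0 p : 0 <= F p by rewrite !addr_ge0.
have shift_sum mu nu : \sum_x w (shift mu x, nu) = S nu.
  rewrite /S [RHS](reindex (shift mu))//; exists (@unshift _ _ mu) => x _.
    exact: shiftK.
  exact: unshiftK.
(* As w is nonnegative, the sum may be enlarged to all periodic plaquettes, where translation
   invariance applies. *)
apply: (@le_trans _ _ (\sum_(p : plaquette d L | (p.1.2 < p.2)%N) F p)).
  rewrite [leRHS](bigID (mem (plaquettes d L B)))/= -[leLHS]addr0 lerD//.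
    rewrite le_eqVlt; apply/orP; left; apply/eqP; apply: eq_bigl => p.
    by rewrite /= andb_idl// inE => /andP[].
  by apply: sumr_ge0.
rewrite sum_oriented_plaquettes sum_bonds.
have FS mu nu : \sum_x F (x, mu, nu) = 2 * S mu + 2 * S nu.
  rewrite /F /= !big_split /= shift_sum shift_sum -!/(S _); ring.
under eq_bigr do under eq_bigr do rewrite FS.
under eq_bigr do rewrite big_split /=.
rewrite big_split /= [X in _ + X](exchange_big_dep xpredT)//= -big_split /=.
rewrite mulr_sumr ler_sum// => mu _.
rewrite !sumr_const -mulrnDr -/(S mu).
(* Direction mu is paired with the larger directions as first index and with the smaller ones as
   second index, d - 1 in all. *)
suff -> : (#|[pred nu : 'I_d | (mu < nu)%N]| + #|[pred nu : 'I_d | (nu < mu)%N]|)%N = d.-1.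
  by rewrite -(mulr_natr (2 * S mu)) mulrAC.
rewrite -cardUI [X in (_ + X)%N]eq_card0 ?addn0; last first.
  by move=> nu; rewrite !inE; case: ltngtP.
transitivity #|predC1 mu|; last by rewrite cardC1 card_ord.
by apply: eq_card => nu; rewrite !inE -(inj_eq val_inj) /= eq_sym neq_ltn.
Qed.

Lemma plaq_umx V p : plaq V p =
  umx (umul (umul (V (b1 p)) (V (b2 p))) (umul (uinv (V (b3 p))) (uinv (V (b4 p))))).
Proof. by rewrite !umxM !umxV mulmxA. Qed.

Lemma plaq_action_ge0 V p : 0 <= plaquette_action (plaq V p).
Proof. by rewrite plaq_umx plaquette_action_ge0. Qed.

(** Two rounds of [plaquette_actionM], each costing a factor 2. *)
Lemma plaq_action_le V p : plaquette_action (plaq V p) <=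
  4 * (plaquette_action (umx (V (b1 p))) + plaquette_action (umx (V (b2 p))) +
       plaquette_action (umx (V (b3 p))) + plaquette_action (umx (V (b4 p)))).
Proof.
rewrite plaq_umx (le_trans (plaquette_actionM _ _))//.
have := plaquette_actionM (V (b1 p)) (V (b2 p)).
have := plaquette_actionM (uinv (V (b3 p))) (uinv (V (b4 p))).
rewrite !plaquette_actionV; lra.
Qed.

Lemma total_action_le V : total_action B V <=
  8 * d.-1%:R * \sum_b plaquette_action (umx (V b)).
Proof.
apply: (@le_trans _ _ (\sum_(p in plaquettes d L B)
    4 * (plaquette_action (umx (V (b1 p))) + plaquette_action (umx (V (b2 p))) +
       plaquette_action (umx (V (b3 p))) + plaquette_action (umx (V (b4 p)))))).
  by apply: ler_sum => p _; exact: plaq_action_le.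
have H := sum_plaquettes_le (fun b => plaquette_action_ge0 (V b)).
rewrite -mulr_sumr; move: H; set X := \sum_(p in _) _; set Y := \sum_b _.
lra.
Qed.

(** The sum of [total_action_le] runs over all periodic bonds; those in the comb and those off B
    carry the unit, whose action is 0. *)
Lemma total_action_comb_fixed (U : config R N d L B) :
  total_action B (comb_fixed U) <=
  8 * d.-1%:R * \sum_(b in bonds d L B :\: @comb d L) plaquette_action (umx (gvar U b)).
Proof.
rewrite (le_trans (total_action_le _))// ler_wpM2l// ?mulr_ge0//.
rewrite [leRHS]big_mkcond /= ler_sum// => b _; rewrite finset.in_setD /comb_fixed.
case: (b \in @comb d L) => /=; first by rewrite plaquette_action1.
by case: ifPn => // bB; rewrite gvar_notin// plaquette_action1.
Qed.

End TotalAction.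

(** * The plaquette attached to each retained free bond *)

Section Plaquettes.
Variables d L : nat.

Lemma bonds_periodic (b : bond d L) : b \in bonds d L Periodic.
Proof. exact: finset.in_setT. Qed.

Local Open Scope nat_scope.
Implicit Types (x : site d L) (b c : bond d L).

(* Lexicographic order on (direction, height), encoded in nat. *)
Definition brank b : nat := b.2 * (d * L).+1 + height b.1.

Lemma height_le x : height x <= d * L.
Proof.
rewrite /height -[X in _ <= X * _]card_ord -sum_nat_const leq_sum// => i _.
exact: ltnW.
Qed.

Lemma brank_dir x y (mu nu : 'I_d) : nu < mu -> brank (x, nu) < brank (y, mu).
Proof.
move=> numu; rewrite /brank /=; apply: (@leq_trans (mu * (d * L).+1)); last exact: leq_addr.
apply: (@leq_trans (nu.+1 * (d * L).+1)); last by rewrite leq_mul2r numu orbT.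
by rewrite mulSn addnC -addSn leq_add2r ltnS height_le.
Qed.

(* For c = (x, mu) off the comb: the plaquette p_{nu mu}(x - e^nu), where
   nu < mu and x_nu <> 0; its bond b2 is c, and its other bonds precede c. *)
Definition back_plaquette c : plaquette d L :=
  if [pick nu : 'I_d | (nu < c.2) && (c.1 nu != 0 :> nat)] is Some nu
  then (unshift nu c.1, nu, c.2) else (c.1, c.2, c.2).

(** The bonds b1 and b3 precede c because their direction nu is smaller than mu; b4 has the
    direction of c but a base point of smaller height. *)
Lemma back_plaquetteP c : c \in bonds d L Free :\: @comb d L ->
  [/\ back_plaquette c \in plaquettes d L Free, b2 (back_plaquette c) = c,
      brank (b1 (back_plaquette c)) < brank c,
      brank (b3 (back_plaquette c)) < brank c &
      brank (b4 (back_plaquette c)) < brank c].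
Proof.
case: c => x mu cR; rewrite /back_plaquette /=.
case: pickP => [nu /andP[numu xnu]|none]; last first.
  by have [nu numu xnu] := free_notin_comb cR; have := none nu; rewrite numu xnu.
have cF : (x, mu) \in bonds d L Free by case/finset.setDP : cR.
have nuF := unshift_free xnu.
have nm : nu != mu by apply: contraTneq numu => ->; rewrite ltnn.
split => /=; last 1 first.
- by rewrite /brank /= (height_unshift xnu) ltn_add2l.
- rewrite inE /= numu nuF unshiftK cF /=; move: nuF cF; rewrite !inE /=.
  move=> yL xL; rewrite [shift mu _ nu]ffunE (negbTE nm) yL.
  by rewrite unshift_neq// eq_sym.
- by rewrite unshiftK.
- exact: brank_dir.
- exact: brank_dir.
Qed.

Lemma back_plaquette_inj : {in bonds d L Free :\: @comb d L &, injective back_plaquette}.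
Proof.
move=> b c /back_plaquetteP[_ bE _ _ _] /back_plaquetteP[_ cE _ _ _] E.
by rewrite -bE -cE E.
Qed.

End Plaquettes.

(** * Bounds by products of one-bond integrals, and periodic against free *)

Section Bounds.
Variables (R : realType) (N d L : nat) (sigma : probability (UN R N) R).
Hypothesis haar_sigma : is_haar sigma.
Local Notation UN := (UN R N).
Variables (a g : R).
Local Notation beta := (a ^ (d%:Z - 4) / g ^+ 2).
Hypothesis beta_ge0 : 0 <= beta.
Local Notation Z := (partition_function d L a g sigma).
Local Notation retained B := (bonds d L B :\: @comb d L).

Lemma partition_functionE B :
  Z B = (\int[tuple_prob sigma #|bonds d L B|]_U (boltzmann B beta (gvar U))%:E)%E.
Proof. by []. Qed.

Lemma measurable_boltzmann_gvar B :
  measurable_fun setT (fun U : config R N d L B => boltzmann B beta (gvar U)).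
Proof. by apply: measurable_boltzmann => b; exact: measurable_gvar. Qed.

(** Stated for every measurable minorant h of the one-bond weight, because the integrand of [z_l]
    involves a chosen angular matrix, whose measurability is not established; [integral_pow_le]
    bridges the two. *)
Lemma partition_function_lower B (h : UN -> R) :
  measurable_fun setT h -> (forall u, 0 <= h u) ->
  (forall u, h u <= expR (- (beta * (8 * d.-1%:R * plaquette_action (umx u))))) ->
  ((\int[sigma]_u (h u)%:E) ^+ #|retained B| <= Z B)%E.
Proof.
move=> mh h0 hle.
have retB : retained B \subset bonds d L B by exact: finset.subsetDl.
(* With W trivial the factors depend on distinct variables, and a constant rank suffices. *)
rewrite -(integral_peel haar_sigma (r := fun=> 0%N) (W := fun=> cst (uone R N)) retB mh h0)//.
rewrite partition_functionE integral_gauge_fixing//.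
apply: ge0_le_integral => //.
- by move=> U _; rewrite lee_fin prodr_ge0.
- apply/measurable_EFinP; under eq_fun do rewrite -big_enum /=.
  apply: measurable_prod => b _; apply: (measurableT_comp mh).
  by apply: measurable_umul; [exact: measurable_cst|exact: measurable_gvar].
- apply/measurable_EFinP; apply: measurable_boltzmann => b.
  exact: measurable_comb_fixed.
move=> U _; rewrite lee_fin /=.
apply: (@le_trans _ _ (\prod_(b in retained B)
    expR (- (beta * (8 * d.-1%:R * plaquette_action (umx (gvar U b))))))).
  by apply: ler_prod => b _; rewrite mul1u h0 hle.
rewrite -expR_sum /boltzmann ler_expR sumrN lerN2 -2!mulr_sumr.
by rewrite ler_wpM2l// total_action_comb_fixed.
Qed.

Lemma partition_function_upper :
  (Z Free <= (z_u d a g sigma) ^+ #|retained Free|)%E.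
Proof.
pose h (u : UN) := expR (- (beta * plaquette_action (umx u))).
have mh : measurable_fun setT h.
  apply: measurableT_comp => //; apply: measurableT_comp => //.
  apply: measurable_funM => //; apply: measurable_plaquette_action.
  by apply: mx_measurable_umx; exact: measurable_id.
have h0 u : 0 <= h u by exact: expR_ge0.
have -> : z_u d a g sigma = (\int[sigma]_u (h u)%:E)%E.
  apply: eq_integral => u _; rewrite /h /plaquette_action; congr (expR _)%:E; ring.
(* Since c is the bond b2 of its plaquette, the product of W c and U_c is a cyclic permutation of
   the plaquette matrix and has the same trace. *)
pose W (c : bond d L) (U : config R N d L Free) : UN := let p := back_plaquette c in
  umul (umul (uinv (gvar U (b3 p))) (uinv (gvar U (b4 p)))) (gvar U (b1 p)).
have retF : retained Free \subset bonds d L Free by exact: finset.subsetDl.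
rewrite -(integral_peel haar_sigma (r := @brank d L) (W := W) retF mh h0); last 2 first.
- move=> c _; apply: measurable_umul; last exact: measurable_gvar.
  by apply: measurable_umul; apply: measurable_uinv; exact: measurable_gvar.
- move=> c e /back_plaquetteP[_ _ r1 r3 r4] eR re U u.
  have eF := fintype.subsetP retF _ eR.
  have neq b : (brank b < brank c)%N -> (b == e) = false.
    by move=> rb; apply: contraTF re => /eqP <-; rewrite -ltnNge.
  by rewrite /W /= !gvar_bupd// !neq.
have mrhs : measurable_fun setT (fun U : config R N d L Free =>
    (\prod_(c in retained Free) h (umul (W c U) (gvar U c)))%:E).
  apply/measurable_EFinP; under eq_fun do rewrite -big_enum /=.
  apply: measurable_prod => b _; apply: (measurableT_comp mh).
  apply: measurable_umul; last exact: measurable_gvar.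
  apply: measurable_umul; last exact: measurable_gvar.
  by apply: measurable_umul; apply: measurable_uinv; exact: measurable_gvar.
rewrite partition_functionE; apply: ge0_le_integral => //.
- by move=> U _; rewrite lee_fin expR_ge0.
- by apply/measurable_EFinP; exact: measurable_boltzmann_gvar.
move=> U _; rewrite lee_fin /h -expR_sum /boltzmann ler_expR sumrN lerN2 -mulr_sumr.
rewrite ler_wpM2l//.
have E c : c \in retained Free -> plaquette_action (umx (umul (W c U) (gvar U c))) =
    plaquette_action (plaq (gvar U) (back_plaquette c)).
  move=> cR; have [_ cE _ _ _] := back_plaquetteP cR.
  rewrite /plaquette_action !mxtraceB /plaq /W cE !umxM !umxV.
  by rewrite -!mulmxA mxtrace_mulC !mulmxA [in RHS]mxtrace_mulC !mulmxA.
(* By injectivity of [back_plaquette] the sum over retained bonds is a sum over distinct plaquettes,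
   a part of the total action. *)
rewrite (eq_bigr _ E) -(finset.big_imset
  (fun p => plaquette_action (plaq (gvar U) p)) (@back_plaquette_inj d L)).
rewrite /total_action.
rewrite [leRHS](finset.big_setID (@back_plaquette d L @: retained Free)%SET).
rewrite (finset.setIidPr _); last first.
  by apply/fintype.subsetP => _ /finset.imsetP[c /back_plaquetteP[cP _ _ _ _] ->].
by rewrite lerDl sumr_ge0// => p _; exact: plaq_action_ge0.
Qed.

(** The free integral is rewritten over periodic configurations, as a function of the free bond
    variables; the periodic action only has additional nonnegative terms. *)
Lemma partition_function_periodic_le : (Z Periodic <= Z Free)%E.
Proof.
rewrite !partition_functionE.
(* Position of a free bond in the enumeration of the periodic bonds. *)
pose phi (j : 'I_#|bonds d L Free|) : 'I_#|bonds d L Periodic| :=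
  Ordinal (etrans (index_bonds Periodic (enum_val j)) (bonds_periodic (enum_val j))).
have phi_inj : injective phi.
  move=> i j /(congr1 val) /= E; apply: enum_val_inj.
  by rewrite -[LHS](nth_index (enum_val i) (s := enum (bonds d L Periodic)))
    ?mem_enum ?bonds_periodic// E nth_index// mem_enum bonds_periodic.
rewrite -(integral_subtuple sigma phi_inj); last 2 first.
- by apply/measurable_EFinP; exact: measurable_boltzmann_gvar.
- by move=> U; rewrite lee_fin expR_ge0.
apply: ge0_le_integral.
- exact: measurableT.
- by move=> U _; rewrite lee_fin expR_ge0.
- by apply/measurable_EFinP; exact: measurable_boltzmann_gvar.
- by apply: (measurableT_comp (iffRL (measurable_EFinP _ _)
    (@measurable_boltzmann_gvar Free)) (measurable_subtuple phi)).
move=> U _; rewrite lee_fin ler_expR lerN2; apply: (ler_wpM2l beta_ge0).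
rewrite (@total_action_ext _ _ _ _ Free _ (gvar U)); last first.
  move=> b bF; rewrite (gvar_in _ bF) tnth_mktuple (gvar_in _ (bonds_periodic b)).
  congr (tnth U _); apply: val_inj => /=; congr (index _ _).
  by rewrite (enum_val_nth b) nth_index// mem_enum.
rewrite /total_action [leRHS](bigID (mem (plaquettes d L Free))) /=.
rewrite -[leLHS]addr0 lerD ?sumr_ge0//; last by move=> p _; exact: plaq_action_ge0.
rewrite le_eqVlt; apply/orP; left; apply/eqP; apply: eq_bigl => p.
by rewrite andb_idl// !inE => /andP[->].
Qed.

End Bounds.

(** * Powers of the integral of a possibly non-measurable function *)

Section LowerIntegral.
Context d (T : measurableType d) (R : realType) (P : probability T R).
Import HBNNSimple.

(** The n-th power is n-Lipschitz on [0, 1], so an approximation of the integral from below yields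
    one of its power. *)
Lemma exprnB_le (x y : R) n : 0 <= y -> y <= x -> x <= 1 ->
  x ^+ n <= y ^+ n + n%:R * (x - y).
Proof.
move=> y0 yx x1; have x0 := le_trans y0 yx.
elim: n => [|n IH]; first by rewrite !expr0 mul0r addr0.
rewrite !exprS -[n.+1]addn1 natrD mulrDl mul1r.
have y1 : y ^+ n <= 1 by rewrite exprn_ile1// (le_trans yx).
apply: (le_trans (ler_wpM2l x0 IH)).
have h1 : x * (n%:R * (x - y)) <= n%:R * (x - y).
  by rewrite ler_piMl// mulr_ge0// subr_ge0.
have h2 : (x - y) * y ^+ n <= x - y by rewrite ler_piMr// subr_ge0.
rewrite mulrDr; lra.
Qed.

(* [f] need not be measurable: its integral is the supremum of the integrals of
   the simple functions below it. *)
Lemma integral_pow_le (f : T -> R) n (z : \bar R) :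
  (forall x, 0 <= f x <= 1) ->
  (forall h : T -> R, measurable_fun setT h -> (forall x, 0 <= h x <= f x) ->
    ((\int[P]_x (h x)%:E) ^+ n <= z)%E) ->
  ((\int[P]_x (f x)%:E) ^+ n <= z)%E.
Proof.
move=> f01 H.
have f0 x : 0 <= f x by case/andP: (f01 x).
have int01 (h : T -> R) : (forall x, 0 <= h x <= f x) ->
    (0 <= \int[P]_x (h x)%:E <= 1)%E.
  move=> hf; have h0 x : (0 <= (h x)%:E)%E by rewrite lee_fin; case/andP: (hf x).
  rewrite integral_ge0//= ge0_integralTE//; apply: ge_ereal_sup => _ [k kh <-].
  rewrite -integralT_nnsfun -(integral_prob_cst P 1).
  apply: ge0_le_integral => //.
  - by move=> x _; rewrite lee_fin.
  - exact/measurable_EFinP.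
  move=> x _; rewrite (le_trans (kh x))// lee_fin.
  case/andP: (hf x) => _ /le_trans; apply; by case/andP: (f01 x).
have [I IE] : exists I : R, (\int[P]_x (f x)%:E)%E = I%:E.
  have /int01 : forall x, 0 <= f x <= f x by move=> x; rewrite f0 lexx.
  by case: (integral _ _ _) => [r _|/andP[_]|/andP[]]//; exists r.
have I1 : I <= 1.
  rewrite -lee_fin -IE.
  by have /int01/andP[] : forall x, 0 <= f x <= f x by move=> x; rewrite f0 lexx.
rewrite IE -EFin_expe.
(* The minorant h = 0 excludes z = -oo. *)
have z0 : (0 <= z)%E.
  apply: le_trans (H (cst 0) (measurable_cst _) _); last by move=> x /=; rewrite lexx f0.
  by rewrite expe_ge0// integral_ge0.
case: z z0 H => [z _ H|_ _|//]; last by rewrite leey.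
rewrite lee_fin; apply/ler_addgt0Pr => e e0.
(* The Lipschitz factor n makes the error n eps <= e; dividing by n + 1 also covers n = 0. *)
pose eps := e / n.+1%:R; have eps0 : 0 < eps by rewrite divr_gt0.
have [_ [h hf <-]] : exists2 x : \bar R, [set sintegral P h | h in
    [set h : {nnsfun T >-> R} | forall x, ((h x)%:E <= (f x)%:E)%E]] x & (I%:E - eps%:E < x)%E.
  rewrite -IE ge0_integralTE//; apply: ub_ereal_sup_adherent => //.
  by rewrite -(ge0_integralTE P (f := EFin \o f))//= IE.
rewrite -integralT_nnsfun => Ih.
have hf' x : 0 <= h x <= f x by rewrite fun_ge0 -lee_fin; exact: hf.
have := H h (measurable_funP h) hf'.
have : (\int[P]_x (h x)%:E <= I%:E)%E.
  rewrite -IE [leRHS]ge0_integralTE//; apply: ereal_sup_ubound.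
  by exists h => //; rewrite integralT_nnsfun.
have := int01 _ hf'; move: Ih; case: (integral _ _ _) => // y.
rewrite -EFin_expe -EFinB lte_fin !lee_fin => Iy /andP[y0 y1] yI yz.
apply: (le_trans (exprnB_le n y0 yI I1)).
rewrite lerD// (@le_trans _ _ (n%:R * eps))//; first by rewrite ler_wpM2l//; lra.
rewrite /eps mulrC -mulrA ler_piMr ?(ltW e0)// mulrC ler_pdivrMr// mul1r ler_nat//.
Qed.

End LowerIntegral.

(** * Angular eigenvalues *)

Section Angles.
Variable R : realType.
Implicit Types (s t : R) (z : R[i]).

Lemma norm_sin_le t : `|sin t| <= `|t|.
Proof.
wlog t0 : t / 0 < t => [H|].
  have [t0|t0|->] := ltgtP t 0; last by rewrite sin0.
    by rewrite -normrN -sinN -[leRHS]normrN H// oppr_gt0.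
  exact: H.
have [c _ E] : exists2 c, c \in `]0, t[%R & sin t - sin 0 = cos c * (t - 0).
  apply: (@MVT R sin cos) => //.
  by apply: continuous_subspaceT => x; exact: continuous_sin.
move: E; rewrite sin0 !subr0 => ->.
by rewrite normrM ler_piMl// cos_max.
Qed.

Lemma one_sub_cosE t : 2 * (1 - cos t) = (2 * sin (t / 2)) ^+ 2.
Proof.
have -> : cos t = cos (t / 2) ^+ 2 *+ 2 - 1 by rewrite -cos_mulr2n; congr cos; field.
by rewrite exprMn sin2cos2; ring.
Qed.

Lemma one_sub_cos_le t : 2 * (1 - cos t) <= t ^+ 2.
Proof.
rewrite one_sub_cosE -[leLHS]real_normK ?num_real// -[leRHS]real_normK ?num_real//.
rewrite lerXn2r ?nnegrE// normrM ger0_norm//.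
have := norm_sin_le (t / 2); rewrite normrM normfV [`|2|]ger0_norm//; lra.
Qed.

(** Equality gives cos(s - t) = 1, so the sine of (s - t) / 2 vanishes, while that angle lies
    strictly between -pi and pi. *)
Lemma expi_inj s t : - pi < s <= pi -> - pi < t <= pi -> expi s = expi t -> s = t.
Proof.
move=> spi tpi [cE sE].
have : cos (s - t) = 1 by rewrite cosB cE sE -!expr2 cos2Dsin2.
have := one_sub_cosE (s - t) => + c1; rewrite c1 subrr mulr0 => /esym/eqP.
rewrite sqrf_eq0 mulf_eq0 pnatr_eq0 /= => /eqP sin0'.
have [st|st|//] := ltgtP s t.
  have : 0 < sin ((t - s) / 2) by apply: sin_gt0_pi; lra.
  by rewrite -opprB mulNr sinN sin0' oppr0 ltxx.
have : 0 < sin ((s - t) / 2) by apply: sin_gt0_pi; lra.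
by rewrite sin0' ltxx.
Qed.

Lemma expi_surj z : `|z| = 1 -> exists2 t : R, - pi < t <= pi & expi t = z.
Proof.
case: z => x y; rewrite normc_def => /(congr1 (@complex.Re R)) /= E.
have {}E : x ^+ 2 + y ^+ 2 = 1.
  by rewrite -(sqr_sqrtr (a := x ^+ 2 + y ^+ 2)) ?addr_ge0 ?sqr_ge0// E expr1n.
have x1 : -1 <= x <= 1.
  by rewrite -ler_norml -(ler_pXn2r (n := 2)) ?nnegrE// real_normK ?num_real//
    expr1n -E lerDl sqr_ge0.
have [/andP[a0 api] ca] := acos_def x1.
have sa : sin (acos x) ^+ 2 = y ^+ 2 by rewrite sin2cos2 ca -E addrAC subrr add0r.
have s0 : 0 <= sin (acos x) by apply: sin_ge0_pi; rewrite a0.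
have [y0|y0] := leP 0 y.
  exists (acos x); first by rewrite api andbT (lt_le_trans _ a0)// oppr_lt0 pi_gt0.
  rewrite /expi ca; congr (_ +i* _); apply/eqP.
  by rewrite -(eqrXn2 (n := 2))// sa.
exists (- acos x).
  rewrite lerNl ltrN2 (le_trans _ a0) ?oppr_le0 ?pi_ge0// andbT lt_neqAle api andbT.
  (* If acos x were pi then y would be 0; so y < 0 keeps - acos x strictly above -pi. *)
  apply: contraTneq y0 => ap; rewrite -leNgt.
  by move: sa; rewrite ap sinpi expr0n /= => /esym/eqP; rewrite sqrf_eq0 => /eqP ->.
rewrite /expi cosN sinN ca; congr (_ +i* _); apply/eqP; rewrite eqr_oppLR.
by rewrite -(eqrXn2 (n := 2)) ?oppr_ge0 ?(ltW y0)// sqrrN sa.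
Qed.

End Angles.

(** * Unitary diagonalization and sums over eigenvalues *)

Section Spectral.
Variables (C : numClosedFieldType) (n : nat).
Implicit Types (A P D : 'M[C]_n).

(** The normal form of the spectral theorem. For a fixed unitary P, polynomials in the matrix act
    entrywise on v. *)
Definition udiag P (v : 'rV[C]_n) : 'M[C]_n := P^t* *m diag_mx v *m P.

Lemma udiagZ P a v : a *: udiag P v = udiag P (a *: v).
Proof. by rewrite /udiag linearZ /= scalemxAl scalemxAr. Qed.

Lemma udiagD P u v : udiag P u + udiag P v = udiag P (u + v).
Proof. by rewrite /udiag linearD /= mulmxDr mulmxDl. Qed.

Lemma udiag0 P : udiag P 0 = 0.
Proof. by rewrite /udiag linear0 mulmx0 mul0mx. Qed.

Lemma udiagX P v m : P \is unitarymx ->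
  udiag P v ^+ m = udiag P (\row_k (v 0 k ^+ m)).
Proof.
move=> Pu; elim: m => [|m IH].
  rewrite expr0 /udiag (_ : diag_mx _ = 1%:M) ?mulmx1.
    by apply: esym; apply: mulmx1C; exact/unitarymxP.
  by apply/matrixP => i j; rewrite !mxE.
rewrite exprS IH -mulmxE /udiag !mulmxA mulmxtVK// -(mulmxA (P^t*)) mulmx_diag.
congr (_ *m diag_mx _ *m _).
by apply/matrixP => i j; rewrite !mxE exprS.
Qed.

Lemma udiag_poly P v (c : nat -> C) m : P \is unitarymx ->
  \sum_(0 <= k < m) c k *: udiag P v ^+ k =
  udiag P (\row_j \sum_(0 <= k < m) c k * v 0 j ^+ k).
Proof.
move=> Pu; elim: m => [|m IH].
  rewrite big_geq// (_ : \row_j _ = 0) ?udiag0//.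
  by apply/rowP => j; rewrite !mxE big_geq.
rewrite big_nat_recr//= IH udiagX// udiagZ udiagD; congr udiag.
by apply/rowP => j; rewrite !mxE big_nat_recr.
Qed.

Lemma udiagE P v i j : udiag P v i j = \sum_k (P^t* i k * P k j) * v 0 k.
Proof. by rewrite mxE; apply: eq_bigr => k _; rewrite mul_mx_diag mxE mulrAC. Qed.

Lemma tC_udiag P v : (udiag P v)^t* = udiag P (map_mx Num.conj v).
Proof.
rewrite /udiag !trmx_mul !map_mxM trmxCK mulmxA tr_diag_mx map_diag_mx.
by rewrite -mulmxA.
Qed.

Lemma char_poly_unitary P A : P \is unitarymx ->
  char_poly (P^t* *m A *m P) = char_poly A.
Proof.
move=> /unitarymxP PP; rewrite /char_poly /char_poly_mx.
have PP' : map_mx polyC (P^t*) *m map_mx polyC P = 1%:M.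
  by rewrite -map_mxM (mulmx1C PP) map_mx1.
have -> : 'X%:M - map_mx polyC (P^t* *m A *m P) =
    map_mx polyC (P^t*) *m ('X%:M - map_mx polyC A) *m map_mx polyC P.
  rewrite mulmxBr mulmxBl !map_mxM; congr (_ - _).
  by rewrite mul_mx_scalar -scalemxAl PP' scalemx1.
rewrite !det_mulmx mulrAC -det_mulmx PP' det1 mul1r //.
Qed.

Lemma char_poly_diag (v : 'rV[C]_n) :
  char_poly (diag_mx v) = \prod_k ('X - (v 0 k)%:P).
Proof.
rewrite char_poly_trig ?diag_mx_is_trig//.
by apply: eq_bigr => k _; rewrite mxE eqxx mulr1n.
Qed.

Lemma normal_diag A : A \is normalmx -> exists2 P, P \is unitarymx &
  A = udiag P (spectral_diag A).
Proof.
move=> /orthomx_spectralP AE; exists (spectralmx A); first exact: spectral_unitarymx.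
by rewrite /udiag -invmx_unitary ?spectral_unitarymx.
Qed.

(** Equal products of linear factors have the same roots up to a permutation, which does not affect
    the sum. *)
Lemma sum_char_poly (F : C -> C) (u v : 'I_n -> C) :
  \prod_k ('X - (u k)%:P) = \prod_k ('X - (v k)%:P) ->
  \sum_k F (u k) = \sum_k F (v k).
Proof.
move=> E; have uv : perm_eq (map u (index_enum 'I_n)) (map v (index_enum 'I_n)).
  by apply: prod_XsubC_eq; rewrite !big_map.
rewrite -(big_map u xpredT F) -(big_map v xpredT F); exact: perm_big.
Qed.

Lemma char_poly_udiag P v : P \is unitarymx ->
  char_poly (udiag P v) = \prod_k ('X - (v 0 k)%:P).
Proof. by move=> Pu; rewrite char_poly_unitary// char_poly_diag. Qed.

Lemma mxtrace_udiag P v : P \is unitarymx -> \tr (udiag P v) = \sum_k v 0 k.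
Proof.
move=> Pu; rewrite /udiag mxtrace_mulC mulmxA (unitarymxP Pu) mul1mx.
by rewrite mxtrace_diag.
Qed.

Lemma mxtraceX_normal A (a : 'I_n -> C) m : A \is normalmx ->
  char_poly A = \prod_k ('X - (a k)%:P) -> \tr (A ^+ m) = \sum_k a k ^+ m.
Proof.
move=> /normal_diag[P Pu ->]; rewrite char_poly_udiag//.
move=> /(sum_char_poly (fun z => z ^+ m)) <-.
by rewrite udiagX// mxtrace_udiag//; apply: eq_bigr => k _; rewrite mxE.
Qed.

End Spectral.

Lemma cvg_sum_finType (K : numFieldType) (V : normedModType K) (I : finType)
    (f : I -> nat -> V) (l : I -> V) :
  (forall i, f i n @[n --> \oo] --> l i) ->
  (\sum_i f i n) @[n --> \oo] --> \sum_i l i.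
Proof.
move=> fl; elim: (index_enum I) => [|i s IH].
  rewrite big_nil (_ : (fun n => _) = fun=> 0); first exact: cvg_cst.
  by apply/funext => n; rewrite big_nil.
rewrite big_cons (_ : (fun n => _) = fun n => f i n + \sum_(j <- s) f j n).
  exact: cvgD.
by apply/funext => n; rewrite big_cons.
Qed.

Section AngularMatrix.
Variables (R : realType) (N : nat).
Implicit Types (U X : 'M[R[i]]_N) (lam : 'I_N -> R).

(** The two parts are written with the coefficients of [cos_coeff] and [sin_coeff], into which the
    exponential series is then split. *)
Lemma imaginaryX m : ('i : R[i]) ^+ m =
  ((~~ odd m)%:R * (-1) ^+ m./2) +i* ((odd m)%:R * (-1) ^+ m.-1./2).
Proof.
have E k : ('i : R[i]) ^+ (k.*2) = ((-1) ^+ k)%:C.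
  by rewrite -mul2n exprM sqr_i rmorphXn rmorphN rmorph1.
rewrite -{1}(odd_double_half m); case: (boolP (odd m)) => om /=.
  rewrite exprS E; have -> : m.-1./2 = m./2.
    by case: m om => //= m /negbTE om; rewrite uphalf_half om.
  by apply/eqP; rewrite eq_complex /= !(mul0r, mul1r, mulr0, subr0, add0r, addr0, oppr0) !eqxx.
by rewrite E mul0r mul1r.
Qed.

Lemma expi_seriesE (t : R) m :
  (m`!%:R)^-1 * ('i * t%:C) ^+ m = cos_coeff t m +i* sin_coeff t m.
Proof.
have -> : (m`!%:R : R[i])^-1 = (m`!%:R^-1)%:C by rewrite fmorphV rmorph_nat.
rewrite exprMn imaginaryX -rmorphXn /cos_coeff /sin_coeff /=; apply/eqP.
rewrite eq_complex /= !(mul0r, mulr0, subr0, add0r, addr0).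
by apply/andP; split; apply/eqP; rewrite mulrC.
Qed.

Lemma cvg_expi (t e : R) : 0 < e -> \forall n \near \oo,
  `|expi t - \sum_(0 <= m < n) (m`!%:R)^-1 * ('i * t%:C) ^+ m| < e%:C.
Proof.
move=> e0; have e2 : 0 < e / 2 by rewrite divr_gt0.
have /cvgrPdist_lt/(_ _ e2) cc : series (cos_coeff t) @ \oo --> cos t.
  by rewrite cos.unlock; exact: is_cvg_series_cos_coeff.
have /cvgrPdist_lt/(_ _ e2) cs : series (sin_coeff t) @ \oo --> sin t.
  by rewrite sin.unlock; exact: is_cvg_series_sin_coeff.
near=> n; have -> : \sum_(0 <= m < n) (m`!%:R)^-1 * ('i * t%:C) ^+ m =
    series (cos_coeff t) n +i* series (sin_coeff t) n.
  rewrite /series /=; elim/big_rec3: _ => // m x y z _ ->.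
  by rewrite expi_seriesE.
apply: (le_lt_trans (norm_le_ReIm _)).
rewrite ReB ImB /= ltcR [ltRHS]splitr ltrD//.
  by near: n; exact: cc.
by near: n; exact: cs.
Unshelve. all: by end_near. Qed.

(** The partial sums of the exponential series are diagonalized by the same P, so convergence
    reduces to the scalar series and finitely many entries. *)
Lemma expmx_udiag (P : 'M[R[i]]_N) lam : P \is unitarymx ->
  expmx ('i *: udiag P (\row_k (lam k)%:C)) = udiag P (\row_k expi (lam k)).
Proof.
move=> Pu; rewrite udiagZ.
set v : 'rV[R[i]]_N := 'i *: _.
pose S n : 'rV[R[i]]_N := \row_k \sum_(0 <= m < n) (m`!%:R)^-1 * ('i * (lam k)%:C) ^+ m.
have SE n : series (fun k => (k`!%:R^-1 *: udiag P v ^+ k : 'M[R[i]^o]_N)) n =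
    udiag P (S n).
  apply: (etrans (udiag_poly _ _ _ Pu)); congr udiag; apply/rowP => k.
  by rewrite !mxE; apply: eq_bigr.
refine (@cvg_lim 'M[R[i]^o]_N _ _ _ _ _ (udiag P (\row_k expi (lam k))) _).
  exact: norm_hausdorff.
rewrite (_ : series _ = fun n => udiag P (S n) : 'M[R[i]^o]_N); last exact/funext.
have cvg_entry i j : (udiag P (S n) i j : R[i]^o) @[n --> \oo] -->
    (udiag P (\row_k expi (lam k)) i j : R[i]^o).
  rewrite udiagE (_ : (fun n => _) = fun n : nat => \sum_k
      ((P^t* i k * P k j) *: (S n 0 k : R[i]^o))); last first.
    by apply/funext => n; rewrite udiagE.
  apply: (@cvg_sum_finType R[i] R[i]^o _
    (fun k n => (P^t* i k * P k j) *: (S n 0 k : R[i]^o))) => k.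
  apply: cvgZl_tmp; apply/cvgrPdist_lt => e; rewrite ltcE /= => /andP[/eqP ei e0].
  have [n0 _ H] := cvg_expi (lam k) e0; exists n0 => // n /H /=.
  by rewrite !mxE (_ : e = (complex.Re e)%:C)//; case: (e) ei => a b /= ->.
apply/cvg_ballP => e e0.
have /filter_forall : forall i : 'I_N * 'I_N, \forall n \near \oo,
    ball (udiag P (\row_k expi (lam k)) i.1 i.2 : R[i]^o) e (udiag P (S n) i.1 i.2).
  by move=> [i j]; move/cvg_ballP : (cvg_entry i j); apply.
by apply: filterS => n H; split=> // i j; exact: (H (i, j)).
Qed.

End AngularMatrix.

Section AngularMatrixSpec.
Variables (R : realType) (N : nat).
Implicit Types (U X : 'M[R[i]]_N) (lam : 'I_N -> R).

Lemma unitary_normal U : U \is unitarymx -> U \is normalmx.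
Proof.
move=> /unitarymxP Uu; apply/normalmxP; rewrite Uu.
by apply: esym; exact: mulmx1C.
Qed.

Lemma spectral_unitary_norm U (P : 'M[R[i]]_N) (v : 'rV[R[i]]_N) k :
  U \is unitarymx -> P \is unitarymx -> U = udiag P v -> `|v 0 k| = 1.
Proof.
move=> Uu Pu UE; have : diag_mx v \is unitarymx.
  have -> : diag_mx v = P *m U *m P^t*.
    by rewrite UE /udiag !mulmxA mulmxtVK// (unitarymxP Pu) mul1mx.
  have Pu' : P^t* \is unitarymx by rewrite trmxC_unitary.
  exact: mul_unitarymx (mul_unitarymx Pu Uu) Pu'.
move=> /unitarymxP/matrixP/(_ k k); rewrite mul_diag_mx !mxE eqxx !mulr1n => vv.
by apply/eqP; rewrite -(pexpr_eq1 (n := 2))// normCK vv.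
Qed.

(** Diagonalize U, take the angles of its eigenvalues in (-pi, pi], and put them on the diagonal in
    the same basis. *)
Lemma exists_angular_mx U : U \is unitarymx -> exists X, is_angular_mx U X.
Proof.
move=> Uu; have [P Pu UE] := normal_diag (unitary_normal Uu).
have /choice[lam lamP] k : exists t : R, - pi < t <= pi /\ expi t = spectral_diag U 0 k.
  have [t tpi tE] := expi_surj (spectral_unitary_norm k Uu Pu UE).
  by exists t.
have vE : spectral_diag U = \row_k expi (lam k).
  by apply/rowP => k; rewrite mxE; case: (lamP k).
exists (udiag P (\row_k (lam k)%:C)); split.
- rewrite tC_udiag; congr udiag; apply/rowP => k; rewrite !mxE.
  by apply/eqP; rewrite eq_complex /= oppr0 !eqxx.
- by apply: (etrans (expmx_udiag lam Pu)); rewrite -vE -UE.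
- exists lam; split; last first.
    by rewrite char_poly_udiag//; apply: eq_bigr => k _; rewrite mxE.
  split=> [k|]; first by case: (lamP k).
  rewrite {1}UE vE char_poly_udiag//.
  by apply: eq_bigr => k _; rewrite mxE.
Qed.

(** By existence, [xget] returns an actual angular matrix and not its default 0. *)
Lemma angular_mxP (U : UN R N) : is_angular_mx (umx U) (angular_mx (umx U)).
Proof. by apply: xgetPex; apply: exists_angular_mx; exact: (svalP U). Qed.

(** As [expi] is injective on (-pi, pi], F of an angle is a function of the eigenvalue, and the
    eigenvalues are fixed by the characteristic polynomial. *)
Lemma angular_eigenvalues_sum U lam lam' (F : R -> R) :
  angular_eigenvalues U lam -> angular_eigenvalues U lam' ->
  \sum_k F (lam k) = \sum_k F (lam' k).
Proof.
move=> [lam_pi lamE] [lam'_pi lam'E].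
pose arg (z : R[i]) := xget 0 [set t : R | - pi < t <= pi /\ expi t = z].
have argE t : - pi < t <= pi -> arg (expi t) = t.
  move=> tpi; rewrite /arg; case: xgetP => [s _ [spi]|/(_ t)[]]//.
  exact: expi_inj.
apply: complexI; rewrite !rmorph_sum /=.
have := @sum_char_poly _ _ (fun z => (F (arg z))%:C)
  (fun k => expi (lam k)) (fun k => expi (lam' k)).
rewrite -lamE -lam'E => /(_ erefl) E.
by rewrite (eq_bigr (fun k => (F (arg (expi (lam k))))%:C)) ?E => [|k _];
  [apply: eq_bigr => k _|]; rewrite argE.
Qed.

(** The trace is first computed from the angles lam' supplied with X, then carried over to any other
    listing lam of the angles of U. *)
Lemma mxtrace_sqr_angular U X lam : is_angular_mx U X -> angular_eigenvalues U lam ->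
  \tr (X *m X) = (\sum_k lam k ^+ 2)%:C.
Proof.
move=> [Xherm _ [lam' [lam'U charX]]] lamU.
have Xn : X \is normalmx by apply/normalmxP; rewrite Xherm.
rewrite (angular_eigenvalues_sum (fun t => t ^+ 2) lamU lam'U).
rewrite mulmxE -expr2 (mxtraceX_normal _ Xn charX) rmorph_sum.
by apply: eq_bigr => k _; rewrite /= rmorphXn.
Qed.

Lemma mxtrace_sqr_onb (theta : 'I_(N ^ 2) -> 'M[R[i]]_N) (x : 'I_(N ^ 2) -> R) :
  is_selfadjoint_onb theta ->
  let X := \sum_al (x al)%:C *: theta al in \tr (X *m X) = (\sum_al x al ^+ 2)%:C.
Proof.
move=> [_ orth] /=; rewrite mulmx_suml linear_sum rmorph_sum; apply: eq_bigr => al _.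
rewrite mulmx_sumr linear_sum (bigD1 al)//= big1 ?addr0 => [|be beal].
  by rewrite -scalemxAl -scalemxAr !linearZ /= orth eqxx mulr1 rmorphXn expr2.
by rewrite -scalemxAl -scalemxAr !linearZ /= orth eq_sym (negbTE beal) !mulr0.
Qed.

Lemma plaquette_action_angular (U : UN R N) lam : angular_eigenvalues (umx U) lam ->
  plaquette_action (umx U) <= \sum_k lam k ^+ 2.
Proof.
move=> [_ charU].
have Un := unitary_normal (svalP U).
have := mxtraceX_normal 1 Un charU; rewrite expr1 => trU.
rewrite /plaquette_action mxtraceB trU mxtrace1 ReB Re_sum.
have -> : complex.Re (N%:R : R[i]) = \sum_(k < N) 1.
  by rewrite -(rmorph_nat (real_complex R)) /= sumr_const card_ord.
rewrite -sumrB mulr_sumr ler_sum// => k _; exact: one_sub_cos_le.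
Qed.

Lemma plaquette_action_le_tr (U : UN R N) :
  let X := angular_mx (umx U) in
  plaquette_action (umx U) <= complex.Re (\tr (X *m X)).
Proof.
have XP := angular_mxP U; have [_ _ [lam [lamU _]]] := XP.
by rewrite /= (mxtrace_sqr_angular XP lamU) /=; exact: plaquette_action_angular.
Qed.

End AngularMatrixSpec.

(** Compares the exponents bond by bond: 8 (d - 1) A(U) <= 2 C^2 (d - 1) Tr X^2, since A(U) <= Tr
    X^2 and C^2 = 4 N >= 4. *)
Lemma z_l_lower (R : realType) (N d L : nat) (a g : R) (sigma : probability (UN R N) R)
    (B : boundary) :
  (1 <= d)%N -> (1 <= N)%N -> is_haar sigma -> 0 <= a ^ (d%:Z - 4) / g ^+ 2 ->
  (z_l d a g sigma ^+ #|bonds d L B :\: @comb d L| <=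
   partition_function d L a g sigma B)%E.
Proof.
move=> d1 N1 haar; set beta := a ^ _ / _ => beta0.
have d1E : d%:R - 1 = d.-1%:R :> R by rewrite -subn1 natrB.
pose s (u : UN R N) := complex.Re (\tr (angular_mx (umx u) *m angular_mx (umx u))).
have s0 u : 0 <= s u.
  exact: le_trans (plaquette_action_ge0 u) (plaquette_action_le_tr u).
have le_s (u : UN R N) : beta * (8 * d.-1%:R * plaquette_action (umx u)) <=
    2 * C2 R N * beta * (d%:R - 1) * s u.
  rewrite d1E /C2.
  have NR : 1 <= N%:R :> R by rewrite ler1n.
  have -> : 2 * (4 * N%:R) * beta * d.-1%:R * s u = beta * (8 * d.-1%:R * (N%:R * s u)).
    by ring.
  apply: (ler_wpM2l beta0); apply: ler_wpM2l; first by rewrite mulr_ge0.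
  by apply: (le_trans (plaquette_action_le_tr u)); exact: (ler_peMl (s0 u) NR).
rewrite /z_l; apply: integral_pow_le => [u|h mh hf].
  rewrite expR_ge0 -[leRHS]expR0 ler_expR !mulNr oppr_le0.
  apply: le_trans (le_s u); apply: (mulr_ge0 beta0).
  by apply: (mulr_ge0 _ (plaquette_action_ge0 u)); rewrite mulr_ge0.
apply: partition_function_lower => // u; first by case/andP: (hf u).
case/andP: (hf u) => _ /le_trans; apply.
by rewrite ler_expR !mulNr lerN2; exact: le_s.
Qed.

Theorem theorem1 (R : realType) (d N L : nat) (a g g0 : R)
    (sigma : probability (UN R N) R) (T : {set bond d L}) :
  (2 <= d <= 4)%N -> (1 <= N)%N -> (0 < L)%N -> ~~ odd L ->
  0 < a <= 1 -> 0 < g0 -> 0 < g ^+ 2 <= g0 ^+ 2 ->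
  is_haar sigma -> maximal_tree T ->
  [/\ forall U : UN R N,
        is_angular_mx (umx U) (angular_mx (umx U)) /\
        (forall (theta : 'I_(N ^ 2) -> 'M[R[i]]_N) (x : 'I_(N ^ 2) -> R)
                (lam : 'I_N -> R),
          is_selfadjoint_onb theta ->
          angular_mx (umx U) = \sum_al (x al)%:C *: theta al ->
          angular_eigenvalues (umx U) lam ->
          \tr (angular_mx (umx U) *m angular_mx (umx U))
            = (\sum_al x al ^+ 2)%:C /\
          \sum_al x al ^+ 2 = \sum_k lam k ^+ 2),
      (z_l d a g sigma ^+ Lambda_r T <= partition_function d L a g sigma Free)%E
        /\ (partition_function d L a g sigma Free
              <= z_u d a g sigma ^+ Lambda_r T)%E &
      [/\ (z_l d a g sigma ^+ (Lambda_r T + Lambda_e d L)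
             <= partition_function d L a g sigma Periodic)%E,
          (partition_function d L a g sigma Periodic
             <= partition_function d L a g sigma Free)%E &
          (partition_function d L a g sigma Free
             <= z_u d a g sigma ^+ Lambda_r T)%E]].
Proof.
move=> /andP[d2 _] N1 L0 _ /andP[a0 _] _ /andP[g0' _] haar mT.
have d1 : (1 <= d)%N by exact: ltnW.
have beta0 : 0 <= a ^ (d%:Z - 4) / g ^+ 2.
  by rewrite divr_ge0 ?(ltW g0')// exprz_ge0// ltW.
(* The given tree T is exchanged for the comb, whose complement has the same number of free
   bonds. *)
have upper : (partition_function d L a g sigma Free <= z_u d a g sigma ^+ Lambda_r T)%E.
  by rewrite (Lambda_rE L0 mT); exact: partition_function_upper.
split=> [U|//|].
- split=> [|theta x lam onb XE lamU]; first exact: angular_mxP.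
  have trX := mxtrace_sqr_angular (angular_mxP U) lamU.
  have trX' : \tr (angular_mx (umx U) *m angular_mx (umx U)) = (\sum_al x al ^+ 2)%:C.
    by rewrite XE mxtrace_sqr_onb.
  by split=> //; apply: complexI; rewrite -trX -trX'.
- by split=> //; rewrite (Lambda_rE L0 mT); exact: z_l_lower.
split=> //; last exact: partition_function_periodic_le.
by rewrite -(card_retained_periodic L0 mT); exact: z_l_lower.
Qed.
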